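(* Let $(M,\alpha_1,\alpha_2,\phi,g)$ be a metric contact pair with decomposable $\phi$ and Reeb vector fields $Z_1,Z_2$, and let $N$ be a connected $\phi$-invariant submanifold of $M$. Then $N$ satisfies one of the following properties: (1) $N$ is even-dimensional and tangent to both Reeb vector fields $Z_1$ and $Z_2$. (2) $N$ is $1$-dimensional and contained in one of the $2$-dimensional leaves of the vertical foliation $\mathcal{V}$. (3) $N$ is of odd dimension $\geq 3$, everywhere tangent to one Reeb vector field $Z_1$ and orthogonal to the other one $Z_2$, or vice versa. (4) $N$ is of odd dimension $\geq 3$, nowhere tangent and nowhere orthogonal to the Reeb vector fields $Z_1$ and $Z_2$, and makes a constant angle along $N$ with each of them.
   Context: All objects are smooth; submanifolds have positive dimension. A contact pair of type $(h,k)$ on a manifold $M$ of dimension $2h+2k+2$ is a pair of $1$-forms $(\alpha_1,\alpha_2)$ such that $\alpha_1\wedge(d\alpha_1)^h\wedge\alpha_2\wedge(d\alpha_2)^k$ is a volume form, $(d\alpha_1)^{h+1}=0$ and $(d\alpha_2)^{k+1}=0$. Convention: $2\,d\alpha(X,Y)=X\alpha(Y)-Y\alpha(X)-\alpha([X,Y])$ for $1$-forms. For $i=1,2$, the integrable subbundle $T\mathcal{F}_i=\{X:\alpha_i(X)=0,\ d\alpha_i(X,Y)=0\ \forall Y\}$ defines the characteristic foliation $\mathcal{F}_i$ of $\alpha_i$. The Reeb vector fields $Z_1,Z_2$ are the unique vector fields with $\alpha_i(Z_j)=\delta_{ij}$ and $i_{Z_i}d\alpha_j=0$ for all $i,j\in\{1,2\}$;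 they commute, and the vertical subbundle $T\mathcal{V}=\mathbb{R}Z_1\oplus\mathbb{R}Z_2$ is tangent to a $2$-dimensional foliation $\mathcal{V}$, the vertical foliation. A contact pair structure $(\alpha_1,\alpha_2,\phi)$ is a contact pair together with a $(1,1)$-tensor field $\phi$ with $\phi^2=-\mathrm{Id}+\alpha_1\otimes Z_1+\alpha_2\otimes Z_2$ and $\phi Z_1=\phi Z_2=0$. $\phi$ is decomposable if $\phi(T\mathcal{F}_i)\subset T\mathcal{F}_i$ for $i=1,2$. A metric contact pair $(M,\alpha_1,\alpha_2,\phi,g)$ is a contact pair structure with a Riemannian metric $g$ that is associated: $g(X,\phi Y)=(d\alpha_1+d\alpha_2)(X,Y)$ and $g(X,Z_i)=\alpha_i(X)$ for $i=1,2$ and all $X,Y$. A submanifold $N\subset M$ is $\phi$-invariant if $\phi(TN)\subset TN$. $Z_i^T$ denotes the component of $Z_i$ (along $N$) tangent to $N$. When $Z_i$ is nowhere orthogonal to $N$, the angle that $Z_i$ makes with $N$ is the angle between $Z_i$ and $Z_i^T$. *)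

(* Defs.v *)
From mathcomp Require Import all_boot all_order all_algebra all_fingroup.
From mathcomp Require Import all_classical all_reals all_analysis.
From Stdlib Require Import Relation_Operators.
Import Order.TTheory GRing.Theory Num.Theory.
Import numFieldNormedType.Exports.

Set Implicit Arguments.
Unset Strict Implicit.
Unset Printing Implicit Defensive.

Local Open Scope classical_set_scope.
Local Open Scope ring_scope.

(* Only used with U open. *)
Fixpoint Ck_on (R : realType) (V W : normedModType R) (k : nat) (U : set V)
    (f : V -> W) : Prop :=
  match k with
  | 0 => forall x, U x -> {for x, continuous f}
  | k'.+1 => (forall x, U x -> differentiable f x) /\
             forall v, Ck_on k' U ('D_v f)
  end.

Definition smooth_on (R : realType) (V W : normedModType R) (U : set V)
    (f : V -> W) : Prop := forall k, Ck_on k U f.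

(* [cfun] is meaningful on [cdom] only, and [cinv] on [cimg] only. *)
Record chart (R : realType) (n : nat) (M : topologicalType) := Chart {
  cdom : set M;
  cfun :> M -> 'rV[R]_n;
  cinv : 'rV[R]_n -> M;
  cimg := cfun @` cdom;
  cdom_open : open cdom;
  cimg_open : open cimg;
  cfunK : {in cdom, cancel cfun cinv};
  cfun_continuous : forall p, cdom p -> {for p, continuous cfun};
  cinv_continuous : forall x, cimg x -> {for x, continuous cinv} }.

Definition compatible (R : realType) (n : nat) (M : topologicalType)
    (c c' : chart R n M) : Prop :=
  smooth_on (c @` (cdom c `&` cdom c')) (c' \o cinv c) /\
  smooth_on (c' @` (cdom c `&` cdom c')) (c \o cinv c').

(* The tangent space at p is represented by 'rV[R]_n, a tangent vector at p
   being identified with its coordinates in the distinguished chart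
   [chart_at p] of the atlas; [coords] and [tvec] below convert to and from
   the coordinates in another chart.  Accordingly a vector field is a function
   M -> 'rV[R]_n, a 1-form is a function M -> {scalar 'rV[R]_n}, and a
   (1,1)-tensor field is a function M -> {linear 'rV[R]_n -> 'rV[R]_n}. *)
Record manifold (R : realType) (n : nat) := Manifold {
  carrier :> topologicalType;
  carrier_hausdorff : hausdorff_space carrier;
  carrier_second_countable : @second_countable carrier;
  atlas : set (chart R n carrier);
  chart_at : carrier -> chart R n carrier;
  atlas_chart_at : forall p, atlas (chart_at p);
  cdom_chart_at : forall p, cdom (chart_at p) p;
  atlas_compatible : forall c c', atlas c -> atlas c' -> compatible c c' }.

Arguments atlas {R n} m.
Arguments chart_at {R n} m _.

Section Fields.
Variables (R : realType) (n : nat) (M : manifold R n).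
Implicit Types (c : chart R n M) (p : M) (u v w : 'rV[R]_n).

Definition coords c p u : 'rV[R]_n :=
  'd (c \o cinv (chart_at M p)) (chart_at M p p) u.

Definition tvec c p u : 'rV[R]_n :=
  'd (chart_at M p \o cinv c) (c p) u.

Definition smooth_field (X : M -> 'rV[R]_n) : Prop :=
  forall c, atlas M c ->
    smooth_on (cimg c) (fun x => coords c (cinv c x) (X (cinv c x))).

Definition local_form (a : M -> {scalar 'rV[R]_n}) c v (x : 'rV[R]_n) : R^o :=
  a (cinv c x) (tvec c (cinv c x) v).

Definition smooth_form (a : M -> {scalar 'rV[R]_n}) : Prop :=
  forall c v, atlas M c -> smooth_on (cimg c) (local_form a c v).

Definition smooth_endo (f : M -> {linear 'rV[R]_n -> 'rV[R]_n}) : Prop :=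
  forall c v, atlas M c ->
    smooth_on (cimg c)
      (fun x => let p := cinv c x in coords c p (f p (tvec c p v))).

Record riemannian_metric (g : M -> 'rV[R]_n -> 'rV[R]_n -> R) : Prop := {
  metric_linear : forall p v, scalar (g p ^~ v);
  metric_sym : forall p u v, g p u v = g p v u;
  metric_pos : forall p u, u != 0 -> 0 < g p u u;
  metric_smooth : forall c v w, atlas M c ->
    smooth_on (cimg c)
      (fun x => let p := cinv c x in g p (tvec c p v) (tvec c p w) : R^o) }.

(* 2 da(X,Y) = X a(Y) - Y a(X) - a([X,Y]), evaluated at p on the fields X, Y
   with constant coordinates u, v in the chart [chart_at p]: their bracket
   vanishes, and u, v are also their values at p. *)
Definition dform (a : M -> {scalar 'rV[R]_n}) p u v : R :=
  let c := chart_at M p in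
  2^-1 * ('D_u (local_form a c v) (c p) - 'D_v (local_form a c u) (c p)).

Definition char_dist (a : M -> {scalar 'rV[R]_n}) p : set 'rV[R]_n :=
  [set u | a p u = 0 /\ forall v, dform a p u v = 0].

Definition vertical_dist (Z1 Z2 : M -> 'rV[R]_n) p : set 'rV[R]_n :=
  [set u | exists s t : R, u = s *: Z1 p + t *: Z2 p].

Definition angle (g : M -> 'rV[R]_n -> 'rV[R]_n -> R) p u v : R :=
  acos (g p u v / (Num.sqrt (g p u u) * Num.sqrt (g p v v))).

(* The component tangent to S, for g p, when S is a linear subspace. *)
Definition tangent_part (g : M -> 'rV[R]_n -> 'rV[R]_n -> R) p
    (S : set 'rV[R]_n) u : 'rV[R]_n :=
  get [set w | S w /\ forall s, S s -> g p (u - w) s = 0].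

End Fields.

Section ExteriorAlgebra.
Variables (R : realType) (V : lmodType R).

Definition form (k : nat) : Type := ('I_k -> V) -> R.

Definition form1 (a : V -> R) : form 1 := fun v => a (v ord0).

Definition form2 (b : V -> V -> R) : form 2 := fun v => b (v ord0) (v ord_max).

(* The normalisation is the one for which the exterior derivative of a 1-form
   carries the factor 1/2. *)
Definition wedge (k l : nat) (a : form k) (b : form l) : form (k + l) :=
  fun v => ((k + l)`!%:R)^-1 * \sum_(s : 'S_(k + l))
    (-1) ^+ s * a (fun i => v (s (lshift l i))) * b (fun j => v (s (rshift k j))).

Fixpoint wedge_pow (b : form 2) (k : nat) : form k.*2 :=
  match k return form k.*2 with
  | 0 => fun _ => 1
  | k'.+1 => wedge b (@wedge_pow b k')
  end.

End ExteriorAlgebra.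

Arguments wedge_pow {R V} b k v.

Section ContactPairs.
Variables (R : realType) (h k : nat).
Let n := (2 + (2 * h + 2 * k))%N.
Variable M : manifold R n.
Variables (a1 a2 : M -> {scalar 'rV[R]_n}) (Z1 Z2 : M -> 'rV[R]_n)
  (phi : M -> {linear 'rV[R]_n -> 'rV[R]_n})
  (g : M -> 'rV[R]_n -> 'rV[R]_n -> R).

Record contact_pair : Prop := {
  contact_smooth1 : smooth_form a1;
  contact_smooth2 : smooth_form a2;
  contact_volume : forall p, exists v,
    wedge (wedge (wedge (form1 (a1 p)) (wedge_pow (form2 (dform a1 p)) h))
                 (form1 (a2 p)))
          (wedge_pow (form2 (dform a2 p)) k) v != 0;
  contact_class1 : forall p v, wedge_pow (form2 (dform a1 p)) h.+1 v = 0;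
  contact_class2 : forall p v, wedge_pow (form2 (dform a2 p)) k.+1 v = 0 }.

Record reeb_fields : Prop := {
  reeb_smooth1 : smooth_field Z1;
  reeb_smooth2 : smooth_field Z2;
  reeb_a1Z1 : forall p, a1 p (Z1 p) = 1;
  reeb_a1Z2 : forall p, a1 p (Z2 p) = 0;
  reeb_a2Z1 : forall p, a2 p (Z1 p) = 0;
  reeb_a2Z2 : forall p, a2 p (Z2 p) = 1;
  reeb_d1Z1 : forall p u, dform a1 p (Z1 p) u = 0;
  reeb_d1Z2 : forall p u, dform a1 p (Z2 p) u = 0;
  reeb_d2Z1 : forall p u, dform a2 p (Z1 p) u = 0;
  reeb_d2Z2 : forall p u, dform a2 p (Z2 p) u = 0 }.

Record contact_pair_structure : Prop := {
  cps_pair : contact_pair;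
  cps_reeb : reeb_fields;
  cps_smooth : smooth_endo phi;
  cps_sqr : forall p u,
    phi p (phi p u) = - u + a1 p u *: Z1 p + a2 p u *: Z2 p;
  cps_Z1 : forall p, phi p (Z1 p) = 0;
  cps_Z2 : forall p, phi p (Z2 p) = 0 }.

Record metric_contact_pair : Prop := {
  mcp_structure : contact_pair_structure;
  mcp_metric : riemannian_metric g;
  mcp_phi : forall p u v, g p u (phi p v) = dform a1 p u v + dform a2 p u v;
  mcp_Z1 : forall p u, g p u (Z1 p) = a1 p u;
  mcp_Z2 : forall p u, g p u (Z2 p) = a2 p u }.

Definition decomposable : Prop :=
  (forall p u, char_dist a1 p u -> char_dist a1 p (phi p u)) /\
  (forall p u, char_dist a2 p u -> char_dist a2 p (phi p u)).

End ContactPairs.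

(* A d-dimensional foliation, given by a foliated atlas: the domain of a
   foliated chart c corresponds to a product A x B, its plaques are the sets
   of constant transverse coordinate [rsubmx (c p)], and changes of foliated
   charts are locally of the form (x, y) |-> (f(x, y), g(y)). *)
Record foliation (R : realType) (d q : nat) (M : manifold R (d + q)) :=
    Foliation {
  fatlas : set (chart R (d + q) M);
  fatlas_cover : forall p, exists2 c, fatlas c & cdom c p;
  fatlas_smooth : forall c c', fatlas c -> atlas M c' -> compatible c c';
  fatlas_product : forall c, fatlas c ->
    exists (A : set 'rV[R]_d) (B : set 'rV[R]_q),
      [/\ open A, connected A, open B, connected B &
          cimg c = [set x | A (lsubmx x) /\ B (rsubmx x)]];
  fatlas_transverse : forall c c' p, fatlas c -> fatlas c' ->
    cdom c p -> cdom c' p -> exists2 U, nbhs p U &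
      forall x y, U x -> U y ->
        rsubmx (c x) = rsubmx (c y) -> rsubmx (c' x) = rsubmx (c' y) }.

Section Foliations.
Variables (R : realType) (d q : nat) (M : manifold R (d + q)).
Variable F : foliation M.

Definition foliation_tangent_to (D : M -> set 'rV[R]_(d + q)) : Prop :=
  forall c p, fatlas F c -> cdom c p ->
    forall u, rsubmx (coords c p u) = 0 <-> D p u.

Definition same_plaque (x y : M) : Prop :=
  exists c, [/\ fatlas F c, cdom c x, cdom c y & rsubmx (c x) = rsubmx (c y)].

(* Two points lie in the same leaf iff a finite chain of plaques joins them. *)
Definition is_leaf (L : set M) : Prop :=
  exists x, L = [set y | clos_refl_trans M same_plaque x y].

End Foliations.

Section Submanifolds.
Variables (R : realType) (m n : nat) (N : manifold R m) (M : manifold R n).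
Implicit Type f : N -> M.

Definition smooth_map f : Prop :=
  continuous f /\
  forall c c', atlas N c -> atlas M c' ->
    smooth_on (c @` (cdom c `&` f @^-1` cdom c')) (c' \o f \o cinv c).

Definition tangent_map f (x : N) : 'rV[R]_m -> 'rV[R]_n :=
  'd (chart_at M (f x) \o f \o cinv (chart_at N x)) (chart_at N x x).

(* Submanifolds are immersed; embedded ones are a particular case. *)
Record submanifold f : Prop := {
  submanifold_smooth : smooth_map f;
  submanifold_injective : injective f;
  submanifold_immersion : forall x, injective (tangent_map f x) }.

Definition tangent_space f (x : N) : set 'rV[R]_n := range (tangent_map f x).

Definition phi_invariant f (phi : M -> {linear 'rV[R]_n -> 'rV[R]_n}) : Prop :=
  forall x u, tangent_space f x u -> tangent_space f x (phi (f x) u).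

Definition tangent_at f (Z : M -> 'rV[R]_n) (x : N) : Prop :=
  tangent_space f x (Z (f x)).

Definition orthogonal_at f (g : M -> 'rV[R]_n -> 'rV[R]_n -> R)
    (Z : M -> 'rV[R]_n) (x : N) : Prop :=
  forall u, tangent_space f x u -> g (f x) (Z (f x)) u = 0.

Definition angle_with f (g : M -> 'rV[R]_n -> 'rV[R]_n -> R)
    (Z : M -> 'rV[R]_n) (x : N) : R :=
  angle g (f x) (Z (f x))
    (tangent_part g (f x) (tangent_space f x) (Z (f x))).

End Submanifolds.

(* Main.v *)
Require Import Defs.
From mathcomp Require Import all_boot all_order all_algebra.
From mathcomp Require Import all_classical all_reals all_analysis.
From mathcomp Require Import ring lra.
From Stdlib Require Import Relation_Operators.
Import Order.TTheory GRing.Theory Num.Theory.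
Import numFieldNormedType.Exports.
Local Open Scope classical_set_scope.
Local Open Scope ring_scope.

(** At a point [x] of [N] let [S] be the tangent space of [N] and let [P] be the Gram matrix
    [(p, q; q, s)] of the components of [Z1], [Z2] tangent to [N].  As [phi] is skew for [g] and
    preserves [S], it kills these components, so they lie in the kernel of [phi], which is spanned
    by the orthonormal pair [Z1], [Z2]; hence [P] is a symmetric idempotent.  Let [Q] be the
    projection of [S] to its intersection with the kernel.  On [S] one has [phi^2 = -1 + Q] and
    [phi Q = Q phi = 0], so that [(phi + Q)^2 = -(1 - 2 Q)], and taking determinants gives
    [(-1)^m det (1 - 2 P) >= 0] ([invariant_subspace]).  So [P] is [0] or [1] when [m] is even, and
    has trace [1] and determinant [0] when [m] is odd.  All the alternatives of the theorem are
    conditions on [P]: [Zi] is tangent when its diagonal entry is [1], orthogonal when it is [0],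
    and the angle is a function of that entry.

    The rest is differential calculus on the pulled back forms [bi = f^* ai], for which
    [(d b1 + d b2)(u, v) = g(u, phi v)] on [S] and which satisfy [b1 = b2 = 0] where [P = 0].

    When [m] is even and [P = 0] at a point, [phi] is invertible on [S] there, so [d b1 + d b2] is
    nondegenerate there and hence nearby.  Where [P = 1] it is degenerate, so [P = 0] nearby;
    then [b1 = b2 = 0] nearby and [d b1 + d b2 = 0], a contradiction ([gram_even]).

    When [m] is odd, suppose [p != 0] at a point.  Nearby [b2 = r b1] with [r = q / p], and
    [p = 1 / (1 + r^2)].  The tangent component [z] of [Z1] is in the kernel of [d b1] and [d b2]
    because [Z1], [Z2] are in the kernel of [d a1] and [d a2], and [b1(z) = p != 0].  Contracting
    [d b2 = dr /\ b1 + r d b1] with [z] gives [dr = w b1].  The same computation on the closed form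
    [w b1] gives [w d b1 = 0].  If [dr != 0] somewhere, then [d b1 = d b2 = 0] there, so [phi = 0]
    on [S], which forces [m = 1] ([ratio_derive0], [gram_near]).  Hence [p] is locally constant
    when [m >= 3]; the case [p = 0], where [s = 1], follows by exchanging the two forms.

    When [m = 1] the tangent line is vertical, so the transverse coordinates of the foliated charts
    are locally constant along [N] ([tangent_submanifold_in_leaf]). *)

Set Implicit Arguments.
Unset Strict Implicit.
Unset Printing Implicit Defensive.

(** * Differentiation and functions of class Ck *)

Section Congruence.
Variables (R : realType) (V W : normedModType R).
Implicit Types (f g : V -> W) (x v : V).

Lemma near_eq_differentiable f g x :
  (\forall y \near x, f y = g y) -> differentiable f x -> differentiable g x.
Proof.
move=> fg df.
have E : g \o shift x = cst (g x) + 'd f x +o_ 0 id.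
  apply/eqaddoP => e e0.
  have /diff_locally/eqaddoP/(_ e e0) H := df.
  have fgx : \forall h \near (0 : V), f (h + x) = g (h + x).
    by move: fg; rewrite (near_shift 0) subr0.
  apply: filterS2 H fgx => h.
  by rewrite !fctE /= /cst => H E; rewrite -E -(nbhs_singleton fg).
have dc : continuous ('d f x) by exact: diff_continuous.
have dgE := diff_unique dc E.
apply/diff_locallyP; split; first by rewrite dgE.
by rewrite dgE.
Qed.

Lemma near_eq_diff f g x : (\forall y \near x, f y = g y) ->
  differentiable f x -> 'd f x = 'd g x :> (V -> W).
Proof.
move=> fg df; apply/funext => v.
by rewrite -!deriveE //; [exact: near_eq_derive | exact: near_eq_differentiable df].
Qed.

Lemma open_near_eq f g (U : set V) x : open U -> (forall y, U y -> f y = g y) ->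
  U x -> \forall y \near x, f y = g y.
Proof. by move=> oU fg Ux; apply: filterS (open_nbhs_nbhs (conj oU Ux)). Qed.

Lemma derive_linear_comb f x (a : R) u v : differentiable f x ->
  'D_(a *: u + v) f x = a *: 'D_u f x + 'D_v f x.
Proof. by move=> df; rewrite !deriveE // linearP. Qed.

Lemma derive_comp (W' : normedModType R) f (h : W -> W') x v :
  differentiable f x -> differentiable h (f x) ->
  'D_v (h \o f) x = 'D_('D_v f x) h (f x).
Proof.
move=> df dh; rewrite [LHS]deriveE; last exact: differentiable_comp.
by rewrite diff_comp // [RHS]deriveE // [in RHS]deriveE.
Qed.

End Congruence.

Lemma diff_comp_apply (R : realType) (V W W' : normedModType R) (f : V -> W)
    (h : W -> W') x v : differentiable f x -> differentiable h (f x) ->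
  'd (h \o f) x v = 'd h (f x) ('d f x v).
Proof. by move=> df dh; have := congr1 (fun k => k v) (diff_comp df dh). Qed.

Lemma linear_row_sum (R : pzRingType) (W : lmodType R) n
    (L : {linear 'rV[R]_n -> W}) u :
  L u = \sum_j u 0 j *: L 'e_j.
Proof.
rewrite {1}(row_sum_delta u) linear_sum.
by apply: eq_bigr => j _; rewrite linearZ.
Qed.

Lemma derive_row_sum (R : realType) (W : normedModType R) n
    (G : 'rV[R]_n -> W) x u : differentiable G x ->
  'D_u G x = \sum_j u 0 j *: 'D_('e_j) G x.
Proof.
move=> dG; rewrite deriveE // linear_row_sum.
by apply: eq_bigr => j _; rewrite deriveE.
Qed.

Section CkClosure.
Variables (R : realType) (V : normedModType R).
Implicit Types (U : set V) (k : nat).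

Lemma Ck_on_eq (W : normedModType R) k U (f g : V -> W) :
  open U -> (forall x, U x -> f x = g x) -> Ck_on k U f -> Ck_on k U g.
Proof.
move=> oU; elim: k f g => [|k IH] f g fg /=.
  move=> cf x Ux; rewrite /prop_for /continuous_at -(fg _ Ux).
  have E := open_near_eq oU fg Ux.
  exact: cvg_trans (near_eq_cvg E) (cf x Ux).
move=> [df Df]; split=> [x Ux|v].
  exact: near_eq_differentiable (open_near_eq oU fg Ux) (df x Ux).
by apply: IH (Df v) => x Ux; apply: near_eq_derive; exact: open_near_eq Ux.
Qed.

Lemma Ck_on_sub (W : normedModType R) k U U' (f : V -> W) :
  U' `<=` U -> Ck_on k U f -> Ck_on k U' f.
Proof.
move=> UU'; elim: k f => [|k IH] f /= => [cf x /UU'|[df Df]]; first exact: cf.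
by split=> [x /UU'|v]; [exact: df | exact: IH].
Qed.

Lemma Ck_on_pred (W : normedModType R) k U (f : V -> W) :
  Ck_on k.+1 U f -> Ck_on k U f.
Proof.
elim: k f => [|k IH] f [df Df].
  by move=> x Ux; apply: differentiable_continuous; exact: df.
by split=> // v; exact: IH.
Qed.

Lemma Ck_on_cst (W : normedModType R) k U (a : W) : Ck_on k U (cst a : V -> W).
Proof.
elim: k a => [|k IH] a /=; first by move=> x _; exact: cst_continuous.
split=> [x _|v]; first exact: differentiable_cst.
have -> : 'D_v (cst a : V -> W) = cst 0 by apply/funext => x; rewrite derive_cst.
exact: IH.
Qed.

Lemma Ck_on_add (W : normedModType R) k U (f g : V -> W) :
  open U -> Ck_on k U f -> Ck_on k U g -> Ck_on k U (fun x => f x + g x).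
Proof.
move=> oU; elim: k f g => [|k IH] f g /=.
  by move=> cf cg x Ux; apply: continuousD; [exact: cf | exact: cg].
move=> [df Df] [dg Dg]; split=> [x Ux|v].
  by apply: differentiableD; [exact: df | exact: dg].
apply: Ck_on_eq (IH _ _ (Df v) (Dg v)) => // x Ux.
by rewrite deriveD //; apply: diff_derivable; auto.
Qed.

Lemma Ck_on_sum (W : normedModType R) k U n (f : 'I_n -> V -> W) :
  open U -> (forall i, Ck_on k U (f i)) -> Ck_on k U (fun x => \sum_i f i x).
Proof.
move=> oU; elim: n f => [|n IH] f Hf.
  by under eq_fun do rewrite big_ord0; exact: Ck_on_cst.
under eq_fun do rewrite big_ord_recr /=.
by apply: Ck_on_add => //; apply: IH => i; exact: Hf.
Qed.

Lemma Ck_on_mul k U (f g : V -> R^o) :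
  open U -> Ck_on k U f -> Ck_on k U g -> Ck_on k U (fun x => f x * g x : R^o).
Proof.
move=> oU; elim: k f g => [|k IH] f g.
  by move=> cf cg x Ux; apply: continuousM; [exact: cf | exact: cg].
move=> Cf Cg; have [df Df] := Cf; have [dg Dg] := Cg; split=> [x Ux|v].
  by apply: differentiableM; [exact: df | exact: dg].
apply: (@Ck_on_eq _ _ _ (fun x => f x * 'D_v g x + g x * 'D_v f x)) => //.
  move=> x Ux; rewrite deriveM //; apply: diff_derivable; auto.
apply: Ck_on_add => //; apply: IH; try exact: Ck_on_pred; [exact: Dg | exact: Df].
Qed.

Lemma Ck_on_inv k U (f : V -> R^o) :
  open U -> (forall x, U x -> f x != 0) -> Ck_on k U f ->
  Ck_on k U (fun x => (f x)^-1 : R^o).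
Proof.
move=> oU f0; elim: k => [|k IH].
  by move=> cf x Ux; apply: continuousV; [exact: f0 | exact: cf].
move=> Cf; have [df Df] := Cf; have CV := IH (Ck_on_pred Cf); split=> [x Ux|v].
  by apply: differentiableV; [exact: df | exact: f0].
apply: (@Ck_on_eq _ _ _ (fun x => (-1) * ((f x)^-1 * ((f x)^-1 * 'D_v f x)))) => //.
  move=> x Ux; rewrite deriveV ?f0 //; last exact/diff_derivable/df.
  transitivity (- (f x ^- 2) * 'D_v f x); last by [].
  by rewrite -exprVn expr2 mulN1r mulNr mulrA.
apply: Ck_on_mul => //; first exact: (Ck_on_cst _ _ (-1 : R^o)).
by apply: Ck_on_mul => //; apply: Ck_on_mul => //; exact: Df.
Qed.

Lemma Ck_on_coord k U n (F : V -> 'rV[R]_n) j :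
  open U -> Ck_on k U F -> Ck_on k U (fun x => F x 0 j : R^o).
Proof.
move=> oU; elim: k F => [|k IH] F.
  move=> cF x Ux.
  apply: (@continuous_comp _ _ _ F (fun u : 'rV[R]_n => u 0 j : R^o)); first exact: cF.
  exact: coord_continuous.
move=> [dF DF]; split=> [x Ux|v].
  apply: (@differentiable_comp _ _ _ _ F (fun u : 'rV[R]_n => u 0 j : R^o)).
    exact: dF.
  exact: differentiable_coord.
apply: Ck_on_eq (IH _ (DF v)) => // x Ux.
by rewrite derive_mx ?mxE //; exact/diff_derivable/dF.
Qed.

(** By the chain rule a directional derivative of the composite is a sum of products of functions of
    class [Ck], one factor being again a composite. *)
Lemma Ck_on_comp k U n (F : V -> 'rV[R]_n) (U' : set 'rV[R]_n)
    (G : 'rV[R]_n -> R^o) :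
  open U -> open U' -> (forall x, U x -> U' (F x)) ->
  Ck_on k U F -> Ck_on k U' G -> Ck_on k U (fun x => G (F x)).
Proof.
move=> oU oU' FU; elim: k G => [|k IH] G.
  by move=> cF cG x Ux; apply: continuous_comp; [exact: cF | exact/cG/FU].
move=> CF CG; have [dF DF] := CF; have [dG DG] := CG; split=> [x Ux|v].
  by apply: differentiable_comp; [exact: dF | exact/dG/FU].
apply: (@Ck_on_eq _ _ _
  (fun x => \sum_j ('D_v F x) 0 j *: 'D_('e_j) G (F x))) => //.
  move=> x Ux; have dFx := dF _ Ux; have dGx := dG _ (FU _ Ux).
  by rewrite (derive_comp v dFx dGx) (derive_row_sum ('D_v F x) dGx).
apply: Ck_on_sum => // j.
apply: (@Ck_on_mul _ _ (fun x => 'D_v F x 0 j) (fun x => 'D_('e_j) G (F x))) => //.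
  by apply: Ck_on_coord => //; exact: DF.
by apply: (IH ('D_('e_j) G)); [exact: Ck_on_pred | exact: DG].
Qed.

End CkClosure.

(** * The mean value theorem and the symmetry of second derivatives *)

Section MeanValue.
Variables (R : realType) (V : normedModType R).
Implicit Types (f : V -> R^o) (x u v : V).

Lemma is_derive_line f x v t : derivable f (x + t *: v) v ->
  is_derive t 1 (fun s : R => f (x + s *: v)) ('D_v f (x + t *: v)).
Proof.
have E : (fun h : R => h^-1 *: (f (h *: v + (x + t *: v)) - f (x + t *: v))) =
    (fun h : R => h^-1 *: (f (x + (h%:A + t) *: v) - f (x + t *: v))).
  apply/funext => h; congr (_ *: (f _ - _)).
  by rewrite [h%:A]mulr1 scalerDl addrCA.
by move=> df; split; rewrite /derivable /derive /= -E.
Qed.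

(** The mean value theorem for the real function [t |-> f (x + t v)], whose derivative is a directional
    derivative of [f]. *)
Lemma mean_value_line f x v :
  (forall t, 0 <= t <= 1 -> derivable f (x + t *: v) v) ->
  exists2 c, 0 <= c <= 1 & f (x + v) - f x = 'D_v f (x + c *: v).
Proof.
move=> df.
have dfI (t : R) : t \in `[0, 1] -> derivable f (x + t *: v) v.
  by rewrite in_itv; exact: df.
have [||c c01] := @MVT R (fun s => f (x + s *: v))
    (fun t => 'D_v f (x + t *: v)) 0 1 ltr01.
- by move=> t t01; apply: is_derive_line; apply: dfI; exact: subset_itv_oo_cc t01.
- apply: derivable_within_continuous => t t01.
  by have [] := is_derive_line (dfI _ t01).
rewrite scale1r scale0r addr0 subr0 mulr1 => ->.
by exists c => //; move: (subset_itv_oo_cc c01); rewrite /= in_itv.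
Qed.

Lemma derive0_ball_cst f x (e : R) :
  (forall y v, ball x e y -> derivable f y v /\ 'D_v f y = 0) ->
  forall y, ball x e y -> f y = f x.
Proof.
move=> Df y; rewrite -ball_normE /= => xy.
have inb t : 0 <= t <= 1 -> ball x e (x + t *: (y - x)).
  move=> /andP[t0 t1]; rewrite -ball_normE /= opprD addNKr normrN normrZ ger0_norm //.
  by rewrite (le_lt_trans _ xy) // distrC ler_piMl.
have [|c c01] := @mean_value_line f x (y - x).
  move=> t t01; by have [] := Df _ (y - x) (inb _ t01).
by rewrite subrKC (Df _ _ (inb _ c01)).2 => /eqP; rewrite subr_eq0 => /eqP.
Qed.

End MeanValue.

Section Schwarz.
Fact sub_swap (R : zmodType) (p q r t : R) : p - q - (r - t) = p - r - (q - t).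
Proof. by rewrite !opprD !opprK addrACA. Qed.

Fact dist_lt_double (R : realDomainType) (x y z e : R) :
  `|x - z| < e -> `|y - z| < e -> `|x - y| < e + e.
Proof.
move=> xz yz; rewrite -(subrKA z) (le_lt_trans (ler_normD _ _)) //.
by rewrite (distrC z) ltrD.
Qed.


Variables (R : realType) (V : normedModType R).
Implicit Types (f : V -> R^o) (x u v : V).

(** The second difference is a difference in the direction [u] of the function [f (y + v) - f y];
    the mean value theorem in the direction [u] and then in the direction [v] turns it into a second
    derivative at an intermediate point.  Being symmetric in [u] and [v], it compares the two mixed
    derivatives. *)
Lemma second_difference f (U : set V) x u v : open U -> Ck_on 2 U f ->
  (forall a b, 0 <= a <= 1 -> 0 <= b <= 1 -> U (x + a *: u + b *: v)) ->
  exists a b, [/\ 0 <= a <= 1, 0 <= b <= 1 &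
    f (x + u + v) - f (x + u) - (f (x + v) - f x) =
    'D_v ('D_u f) (x + a *: u + b *: v)].
Proof.
move=> oU [df Df] inU.
have r0 : 0 <= (0 : R) <= 1 by rewrite lexx ler01.
have r1 : 0 <= (1 : R) <= 1 by rewrite lexx ler01.
pose G y : R^o := f (y + v) - f y.
have dG a : 0 <= a <= 1 ->
    is_derive (x + a *: u) u G ('D_u f (x + a *: u + v) - 'D_u f (x + a *: u)).
  move=> a01; rewrite /G.
  have d1 : derivable f (x + a *: u + v) u.
    by apply/diff_derivable/df; rewrite -[v]scale1r; exact: inU.
  have d0 : derivable f (x + a *: u) u.
    by apply/diff_derivable/df; rewrite -[_ + _]addr0 -(scale0r v); exact: inU.
  apply: is_deriveB; last exact: derivableP.
  split; first by move: d1; rewrite /derivable; under eq_fun do rewrite /= addrA.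
  by rewrite /derive; under eq_fun do rewrite /= -addrA.
have [a a01 Ea] : exists2 a, 0 <= a <= 1 & G (x + u) - G x =
    'D_u G (x + a *: u).
  by apply: mean_value_line => t /dG[].
have [b b01 Eb] : exists2 b, 0 <= b <= 1 &
    'D_u f (x + a *: u + v) - 'D_u f (x + a *: u) =
    'D_v ('D_u f) (x + a *: u + b *: v).
  apply: (@mean_value_line _ _ ('D_u f)) => t t01.
  exact: (@diff_derivable _ _ _ ('D_u f) _ v ((Df u).1 _ (inU _ _ a01 t01))).
exists a, b; split => //; rewrite -Eb -(@derive_val _ _ _ _ _ _ _ (dG _ a01)) -Ea.
by [].
Qed.

Lemma derive_scale2 f (U : set V) s u v y : open U -> Ck_on 2 U f -> U y ->
  'D_(s *: v) ('D_(s *: u) f) y = s * (s * 'D_v ('D_u f) y).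
Proof.
move=> oU [df Df] Uy.
have E : \forall z \near y, 'D_(s *: u) f z = s *: 'D_u f z.
  apply: (open_near_eq oU) Uy => z Uz.
  by rewrite -[_ *: u]addr0 derive_linear_comb ?derive0 ?addr0 //; exact: df.
rewrite (near_eq_derive _ E) deriveZ; last exact/diff_derivable/(Df u).1.
congr (_ * _); rewrite -[_ *: v]addr0 derive_linear_comb ?derive0 ?addr0 //.
exact: (Df u).1.
Qed.

(** Applied to small multiples [s u], [s v] in both orders, [second_difference] gives equal values of
    the two mixed derivatives at two points near [x]; by continuity their values at [x] are as close
    as one likes. *)
Lemma derive_swap f (U : set V) x u v : open U -> Ck_on 2 U f -> U x ->
  'D_u ('D_v f) x = 'D_v ('D_u f) x.
Proof.
move=> oU Cf Ux; apply/eqP/negPn/negP => AB.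
set A := 'D_u _ x in AB; set B := 'D_v _ x in AB.
pose e := `|A - B| / 2.
have e0 : 0 < e by rewrite divr_gt0 // normr_gt0 subr_eq0.
have cA : \forall y \near x, `|A - 'D_u ('D_v f) y| < e.
  by have /cvgrPdist_lt H := (Cf.2 v).2 u x Ux; exact: H.
have cB : \forall y \near x, `|B - 'D_v ('D_u f) y| < e.
  by have /cvgrPdist_lt H := (Cf.2 u).2 v x Ux; exact: H.
have /nbhs_ballP[d /= d0 Hd] : \forall y \near x, [/\ `|A - 'D_u ('D_v f) y| < e,
    `|B - 'D_v ('D_u f) y| < e & U y].
  by apply: filterS3 cA cB (open_nbhs_nbhs (conj oU Ux)).
have [s s0 sd] : exists2 s, 0 < s & s * (`|u| + `|v|) < d.
  have c0 : 0 < `|u| + `|v| + 1 by rewrite ltr_wpDl // addr_ge0.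
  exists (d / (2 * (`|u| + `|v| + 1))); first by rewrite divr_gt0 // mulr_gt0.
  rewrite mulrAC ltr_pdivrMr ?mulr_gt0 // ltr_pM2l //.
  by rewrite mulr_natl; have := c0; lra.
have inb (w w' : V) a b : `|w| + `|w'| = `|u| + `|v| -> 0 <= a <= 1 -> 0 <= b <= 1 ->
    ball x d (x + a *: (s *: w) + b *: (s *: w')).
  move=> ww /andP[a0 a1] /andP[b0 b1].
  rewrite -ball_normE /= -addrA opprD addNKr normrN.
  apply: le_lt_trans sd.
  rewrite -ww (le_trans (ler_normD _ _)) // mulrDr !normrZ (ger0_norm a0) (ger0_norm b0) (gtr0_norm s0).
  by apply: lerD; rewrite ler_piMl // mulr_ge0 // (ltW s0).
have oB : open (ball x d) by exact: ball_open.
have CB : Ck_on 2 (ball x d) f by apply: Ck_on_sub Cf => y /Hd[].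
have [a [b [a01 b01 E1]]] := second_difference oB CB (fun a b => inb u v a b erefl).
have [a' [b' [a'01 b'01 E2]]] := second_difference oB CB
  (fun a b => inb v u a b (addrC _ _)).
have i1 := inb u v a b erefl a01 b01; have i2 := inb v u a' b' (addrC _ _) a'01 b'01.
rewrite (derive_scale2 s u v oB CB i1) in E1.
rewrite (derive_scale2 s v u oB CB i2) in E2.
have : s * (s * 'D_v ('D_u f) (x + a *: (s *: u) + b *: (s *: v))) =
       s * (s * 'D_u ('D_v f) (x + a' *: (s *: v) + b' *: (s *: u))).
  apply: etrans (esym E1) _; apply: etrans E2.
  by rewrite (addrAC x (s *: v)); exact: sub_swap.
move=> /(mulfI (lt0r_neq0 s0))/(mulfI (lt0r_neq0 s0)) E.
have [_ h1 _] := Hd _ i1; have [h2 _ _] := Hd _ i2.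
have : `|A - B| < e + e.
  exact: (dist_lt_double h2 (eq_ind _ (fun X => `|B - X| < e) h1 _ E)).
by rewrite /e -splitr ltxx.
Qed.

End Schwarz.

(** * The exterior derivative of a 1-form on a normed space *)

(** The exterior derivative of the 1-form [A] on the constant fields [u], [v], whose bracket vanishes.
    There is no factor [1/2] here. *)
Definition ext_d (R : realType) (V : normedModType R) (A : V -> V -> R^o)
    (x u v : V) : R := 'D_u (A ^~ v) x - 'D_v (A ^~ u) x.

Section ExteriorDerivative.
Variables (R : realType) (V : normedModType R).
Implicit Types (A B : V -> V -> R^o) (U : set V) (x u v : V) (s : V -> R^o).

Lemma near_eq_ext_d A B x u v :
  (\forall y \near x, A y =1 B y) -> ext_d A x u v = ext_d B x u v.
Proof.
by move=> AB; congr (_ - _); apply: near_eq_derive; apply: filterS AB => y ->.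
Qed.

(** This is [d(s A) = ds /\ A + s dA]. *)
Lemma ext_d_mul U s A B x u v : open U -> U x ->
  (forall y w, U y -> B y w = s y * A y w) ->
  differentiable s x -> (forall w, differentiable (A ^~ w) x) ->
  ext_d B x u v =
    'D_u s x * A x v - 'D_v s x * A x u + s x * ext_d A x u v.
Proof.
move=> oU Ux BA ds dA.
have E w w' : 'D_w (B ^~ w') x = s x * 'D_w (A ^~ w') x + A x w' * 'D_w s x.
  have BAw : \forall y \near x, (B ^~ w') y = (s * A ^~ w') y.
    by apply: (open_near_eq oU) Ux => y Uy /=; exact: BA.
  rewrite (near_eq_derive w BAw) deriveM //; exact: diff_derivable.
by rewrite /ext_d !E; ring.
Qed.

(** Contracting [d(s A) = ds /\ A + s dA] with [z] leaves [ds(z) A = A(z) ds], so [ds] is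
    proportional to [A]; the conclusion says so without dividing. *)
Lemma ext_d_kernel U s A B x z : open U -> U x ->
  (forall y w, U y -> B y w = s y * A y w) ->
  differentiable s x -> (forall w, differentiable (A ^~ w) x) ->
  A x z != 0 -> (forall u, ext_d A x z u = 0) -> (forall u, ext_d B x z u = 0) ->
  forall u v, 'D_u s x * A x v = 'D_v s x * A x u.
Proof.
move=> oU Ux BA ds dA Az dAz dBz.
have E u : 'D_u s x * A x z = 'D_z s x * A x u.
  have := dBz u; rewrite (ext_d_mul z u oU Ux BA ds dA) dAz mulr0 addr0.
  by move/eqP; rewrite subr_eq0 => /eqP.
move=> u v; apply: (mulIf Az).
by rewrite mulrAC E [RHS]mulrAC E mulrAC.
Qed.

(** By [ext_d_kernel] the differential of [r] is a multiple [w b1], with [w] read off on [v0].  This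
    form is closed by the symmetry of second derivatives, so [ext_d_kernel] applies again, to
    [dr = w b1]: [dw] is a multiple of [b1] too, and what remains of [d(w b1) = 0] is [w d b1 = 0]. *)
Lemma ratio_derive0 U (b1 b2 : V -> V -> R^o) (r : V -> R^o) v0 x :
  open U -> (forall w, Ck_on 2 U (b1 ^~ w)) -> Ck_on 2 U r ->
  (forall y w, U y -> b2 y w = r y * b1 y w) ->
  (forall y, U y -> b1 y v0 != 0) ->
  (forall y, U y -> exists z, [/\ b1 y z != 0,
     forall u, ext_d b1 y z u = 0 & forall u, ext_d b2 y z u = 0]) ->
  U x -> (exists u, 'D_u r x != 0) ->
  forall u v, ext_d b1 x u v = 0 /\ ext_d b2 x u v = 0.
Proof.
move=> oU Cb Cr b21 v0U ker Ux [u0 ru0].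
have db y w : U y -> differentiable (b1 ^~ w) y by move=> Uy; exact: (Cb w).1.
have dr y : U y -> differentiable r y by move=> Uy; exact: Cr.1.
have rb y u v : U y -> 'D_u r y * b1 y v = 'D_v r y * b1 y u.
  move=> Uy; have [z [z0 z1 z2]] := ker _ Uy.
  by apply: (ext_d_kernel oU Uy b21 (dr _ Uy) _ z0 z1 z2) => w; exact: db.
pose w y : R^o := 'D_v0 r y * (b1 y v0)^-1.
have Cw : Ck_on 1 U w.
  apply: Ck_on_mul => //; first exact: Cr.2.
  by apply: Ck_on_inv => //; apply: Ck_on_pred; exact: Cb.
have dw : differentiable w x by exact: Cw.1.
have rw y u : U y -> 'D_u r y = w y * b1 y u.
  by move=> Uy; rewrite /w mulrAC -(rb y u v0 Uy) mulfK // v0U.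
pose dr' y u : R^o := 'D_u r y.
have ddr u v : ext_d dr' x u v = 0.
  by rewrite /ext_d /dr' (derive_swap u v oU Cr Ux) subrr.
have [z [z0 z1 z2]] := ker _ Ux.
have dbx w' : differentiable (b1 ^~ w') x by exact: db.
have wb := ext_d_kernel oU Ux rw dw dbx z0 z1 (ddr z).
have d1 u v : ext_d b1 x u v = 0.
  have := ddr u v; rewrite (ext_d_mul u v oU Ux rw dw dbx) wb subrr add0r.
  move/eqP; rewrite mulf_eq0 => /orP[/eqP w0|/eqP //].
  by move: ru0; rewrite rw // w0 mul0r eqxx.
move=> u v; split => //.
by rewrite (ext_d_mul u v oU Ux b21 (dr _ Ux) dbx) rb // subrr d1 mulr0 addr0.
Qed.

End ExteriorDerivative.

Section Pullback.
Variables (R : realType) (V : normedModType R) (n : nat).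
Implicit Types (A : 'rV[R]_n -> 'rV[R]_n -> R^o) (F : V -> 'rV[R]_n).

Fact sub_add_eq (p q a s t : R) : s = t -> p - q = p + a * s - (q + a * t).
Proof. by move=> ->; rewrite opprD addrACA subrr addr0. Qed.

Lemma derive_coord F x v j : differentiable F x ->
  'D_v F x 0 j = 'D_v (fun y => F y 0 j : R^o) x.
Proof. by move=> dF; rewrite derive_mx ?mxE //; exact: diff_derivable. Qed.

Lemma scalar_row_sum (a : 'rV[R]_n -> R^o) u : scalar a ->
  a u = \sum_j u 0 j * a 'e_j.
Proof.
move=> la; rewrite {1}(row_sum_delta u).
elim/big_rec2: _ => [|j x y _ <-]; last exact: la.
by have := la (-1) 0 0; rewrite scaler0 addr0 mulN1r addNr.
Qed.

Lemma ext_d_row_sum A x u v : (forall y, scalar (A y)) ->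
  (forall w, differentiable (A ^~ w) x) ->
  ext_d A x u v = \sum_j (v 0 j * 'D_u (A ^~ 'e_j) x - u 0 j * 'D_v (A ^~ 'e_j) x).
Proof.
move=> lA dA.
have E w w' : 'D_w (A ^~ w') x = \sum_j w' 0 j * 'D_w (A ^~ 'e_j) x.
  have -> : A ^~ w' = \sum_j (w' 0 j *: A ^~ 'e_j).
    apply/funext => y; rewrite fct_sumE; exact: scalar_row_sum.
  rewrite derive_sum; last first.
    by move=> j; apply: derivableZ; exact: diff_derivable.
  by apply: eq_bigr => j _; rewrite deriveZ //; exact: diff_derivable.
by rewrite /ext_d !E sumrB.
Qed.

(** In coordinates the pulled back form is [\sum_j A_j(F) dF_j]; differentiating [dF_j] contributes
    second derivatives of [F_j], which cancel by symmetry. *)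
Lemma ext_d_pullback A F (U : set V) x u v : open U -> U x -> Ck_on 2 U F ->
  (forall y, scalar (A y)) -> (forall w, differentiable (A ^~ w) (F x)) ->
  ext_d (fun z w => A (F z) ('D_w F z)) x u v =
  ext_d A (F x) ('D_u F x) ('D_v F x).
Proof.
move=> oU Ux CF lA dA.
have dF y : U y -> differentiable F y by exact: CF.1.
pose Fj j y : R^o := F y 0 j.
have CFj j : Ck_on 2 U (Fj j) by exact: Ck_on_coord.
pose Aj j y : R^o := A (F y) 'e_j.
have dAj j : differentiable (Aj j) x.
  by apply: (@differentiable_comp _ _ _ _ F (A ^~ 'e_j)) => //; exact: dF.
have E w w' : 'D_w (fun z => A (F z) ('D_w' F z)) x =
    \sum_j ('D_w' F x 0 j * 'D_('D_w F x) (A ^~ 'e_j) (F x) +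
            A (F x) 'e_j * 'D_w ('D_w' (Fj j)) x).
  have BE : \forall z \near x,
      A (F z) ('D_w' F z) = (\sum_j ('D_w' (Fj j) * Aj j)) z.
    apply: (open_near_eq oU) Ux => z Uz.
    rewrite fct_sumE (scalar_row_sum _ (lA _)); apply: eq_bigr => j _.
    by rewrite derive_coord //; exact: dF.
  rewrite (near_eq_derive w BE) derive_sum; last first.
    move=> j; apply: derivableM; apply: diff_derivable => //.
    exact: ((CFj j).2 w').1.
  apply: eq_bigr => j _; rewrite deriveM; first last.
  - exact: diff_derivable.
  - by apply: diff_derivable; exact: ((CFj j).2 w').1.
  rewrite (derive_comp (f := F) (h := A ^~ 'e_j) w (dF _ Ux) (dA _)).
  by rewrite (derive_coord _ _ (dF _ Ux)).
rewrite ext_d_row_sum // /ext_d !E -sumrB; apply: eq_bigr => j _.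
exact: (esym (sub_add_eq _ _ _ (derive_swap u v oU (CFj j) Ux))).
Qed.

End Pullback.

(** Where the differential of the ratio did not vanish, [ratio_derive0] would make both exterior
    derivatives zero, against the last hypothesis; so the ratio is constant on balls. *)
Lemma ratio_locally_constant (R : realType) (V : normedModType R) (U : set V)
    (b1 b2 : V -> V -> R^o) v0 z0 :
  open U -> U z0 ->
  (forall w, Ck_on 2 U (b1 ^~ w)) -> (forall w, Ck_on 2 U (b2 ^~ w)) ->
  b1 z0 v0 != 0 ->
  (forall z w, U z -> b1 z v0 != 0 -> b2 z w * b1 z v0 = b2 z v0 * b1 z w) ->
  (forall z, U z -> b1 z v0 != 0 -> exists zeta, [/\ b1 z zeta != 0,
     forall u, ext_d b1 z zeta u = 0 & forall u, ext_d b2 z zeta u = 0]) ->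
  (forall z, U z -> exists u v, ext_d b1 z u v + ext_d b2 z u v != 0) ->
  \forall z \near z0, b1 z v0 != 0 /\ b2 z v0 / b1 z v0 = b2 z0 v0 / b1 z0 v0.
Proof.
move=> oU Uz0 C1 C2 b10 col ker nz.
pose U' := [set z | U z /\ b1 z v0 != 0].
have oU' : open U'.
  rewrite openE => z [Uz bz].
  have cb : {for z, continuous (b1 ^~ v0)}.
    by apply: differentiable_continuous; exact: (C1 v0).1.
  have bn : \forall y \near z, b1 y v0 != 0 by exact: cvgr_neq0 cb bz.
  by apply: filterS2 (open_nbhs_nbhs (conj oU Uz)) bn.
have sub : U' `<=` U by move=> z [].
pose r z : R^o := b2 z v0 * (b1 z v0)^-1.
have Cr : Ck_on 2 U' r.
  apply: Ck_on_mul => //; first exact: Ck_on_sub (C2 v0).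
  apply: Ck_on_inv => //; first by move=> z [].
  exact: Ck_on_sub (C1 v0).
have Dr z u : U' z -> 'D_u r z = 0.
  move=> U'z; apply/eqP/negPn/negP => Dn.
  have [u' [v' /eqP[]]] := nz _ U'z.1.
  have C1' w : Ck_on 2 U' (b1 ^~ w) by exact: Ck_on_sub (C1 w).
  have b21 y w : U' y -> b2 y w = r y * b1 y w.
    by move=> [Uy y0]; rewrite /r mulrAC -col // mulfK.
  have v0U y : U' y -> b1 y v0 != 0 by case.
  have ker' y : U' y -> exists zeta, [/\ b1 y zeta != 0,
     forall u, ext_d b1 y zeta u = 0 & forall u, ext_d b2 y zeta u = 0].
    by case; exact: ker.
  have [-> ->] := ratio_derive0 oU' C1' Cr b21 v0U ker' U'z (ex_intro _ u Dn) u' v'.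
  by rewrite addr0.
have /nbhs_ballP[e /= e0 He] : nbhs z0 U' by exact: open_nbhs_nbhs.
apply/nbhs_ballP; exists e => //= z Bz; split; first exact: (He z Bz).2.
apply: (@derive0_ball_cst _ _ r z0 e _ z Bz) => y v /He U'y; split; last exact: Dr.
exact/diff_derivable/Cr.1.
Qed.

(** * Invariant subspaces of a skew endomorphism *)

(** Both sides are the determinant of the block matrix with diagonal blocks [1] and off-diagonal
    blocks [A], [B], reduced by block elimination in two ways. *)
Lemma det_1B_mulC (R : comPzRingType) m d (A : 'M[R]_(m, d)) (B : 'M[R]_(d, m)) :
  \det (1%:M - A *m B) = \det (1%:M - B *m A).
Proof.
have E1 : (block_mx (1%:M - A *m B) A 0 (1%:M)) *m (block_mx (1%:M) 0 B (1%:M)) =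
          block_mx (1%:M) A B (1%:M) :> 'M[R]_(m + d).
  rewrite mulmx_block !mulmx1 !mul1mx ?mul0mx ?mulmx0 !add0r.
  by rewrite subrK.
have E2 : (block_mx (1%:M) 0 B (1%:M)) *m (block_mx (1%:M) A 0 (1%:M - B *m A)) =
          block_mx (1%:M) A B (1%:M) :> 'M[R]_(m + d).
  by rewrite mulmx_block !mulmx1 !mul1mx !mul0mx ?mulmx0 ?addr0 subrKC.
have := congr1 determinant (etrans E1 (esym E2)).
by rewrite !det_mulmx !det_ublock !det_lblock !det1 !mulr1 !mul1r.
Qed.

Lemma det_block_scalar (R : comPzRingType) (a b c d : R) :
  \det (block_mx (a%:M) (b%:M) (c%:M) (d%:M) : 'M[R]_(1 + 1)) = a * d - b * c.
Proof.
rewrite (expand_det_row _ 0) big_ord_recl big_ord1 /cofactor !det_mx11 !mxE.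
have s0 : fintype.split (0 : 'I_(1 + 1)) = inl 0 :> 'I_1 + 'I_1.
  by rewrite -(unsplitK (inl 0)); congr fintype.split; apply: val_inj.
have s1 : fintype.split (lift 0 0 : 'I_(1 + 1)) = inr 0 :> 'I_1 + 'I_1.
  by rewrite -(unsplitK (inr 0)); congr fintype.split; apply: val_inj.
have l0 : lift (lift 0 0 : 'I_(1 + 1)) 0 = 0 by apply: val_inj.
rewrite l0 !(s0, s1, mxE) /= !mulr1n addn0 expr0 mul1r expr1 mulN1r.
by rewrite mulrN.
Qed.

Lemma symmetric_idempotent2 (R : realFieldType) (p q s : R) :
  p = p ^+ 2 + q ^+ 2 -> q = q * (p + s) -> s = s ^+ 2 + q ^+ 2 ->
  [\/ [/\ p = 0, q = 0 & s = 0], [/\ p = 1, q = 0 & s = 1] |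
      p + s = 1 /\ p * s = q ^+ 2].
Proof.
have [-> Ep _ Es|q0 Ep Eq Es] := eqVneq q 0; last first.
  have E : p + s = 1 by apply: (mulfI q0); rewrite -Eq mulr1.
  by apply: Or33; split => //; rewrite -[s](addKr p) E {2}Ep; nra.
have idem (x : R) : x = x ^+ 2 + 0 ^+ 2 -> x = 0 \/ x = 1.
  move=> E; have : x * (x - 1) == 0 by apply/eqP; nra.
  by rewrite mulf_eq0 subr_eq0 => /orP[] /eqP; [left | right].
case: (idem _ Ep) => ->; case: (idem _ Es) => ->.
- exact: Or31.
- by apply: Or33; rewrite add0r mul0r expr0n.
- by apply: Or33; rewrite addr0 mulr0 expr0n.
- exact: Or32.
Qed.

Section InvariantSubspace.
Variables (R : realType) (m n : nat) (g : 'rV[R]_n -> 'rV[R]_n -> R)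
  (phi : {linear 'rV[R]_n -> 'rV[R]_n}) (L : {linear 'rV[R]_m -> 'rV[R]_n})
  (Z1 Z2 : 'rV[R]_n).
Hypothesis g_scalar : forall v, scalar (g ^~ v).
Hypothesis g_sym : forall u v, g u v = g v u.
Hypothesis g_pos : forall u, u != 0 -> 0 < g u u.
Hypothesis g_Z12 : g Z1 Z2 = 0.
Hypothesis phi_sqr : forall u,
  phi (phi u) = - u + g u Z1 *: Z1 + g u Z2 *: Z2.
Hypothesis phi_Z1 : phi Z1 = 0.
Hypothesis phi_Z2 : phi Z2 = 0.
Hypothesis phi_skew : forall u v, g u (phi v) = - g v (phi u).
Hypothesis L_inj : injective L.
Hypothesis L_inv : forall u, exists w, L w = phi (L u).

Let gPl a u v w : g (a *: u + v) w = a * g u w + g v w. Proof. exact: g_scalar. Qed.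
Let g0l w : g 0 w = 0.
Proof. by have := gPl (-1) 0 0 w; rewrite scaler0 addr0 mulN1r addNr. Qed.
Let gDl u v w : g (u + v) w = g u w + g v w.
Proof. by rewrite -[u in LHS]scale1r gPl mul1r. Qed.
Let gZl a u w : g (a *: u) w = a * g u w.
Proof. by rewrite -[_ *: _]addr0 gPl g0l addr0. Qed.
Let gNl u w : g (- u) w = - g u w.
Proof. by rewrite -scaleN1r gZl mulN1r. Qed.
Let gDr u v w : g w (u + v) = g w u + g w v. Proof. by rewrite g_sym gDl !(g_sym w). Qed.
Let gZr a u w : g w (a *: u) = a * g w u. Proof. by rewrite g_sym gZl (g_sym w). Qed.

Lemma inner_eq0 u : g u u = 0 -> u = 0.
Proof. by move=> gu; apply/eqP/negP => /negP/g_pos; rewrite gu ltxx. Qed.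

(** An equation in the source of [L] can be checked after pairing with the image of [L]. *)
Let pullback_nondeg u v : (forall w, g (L u) (L w) = g (L v) (L w)) -> u = v.
Proof.
move=> uv; apply/eqP; rewrite -subr_eq0; apply/eqP; apply: L_inj.
rewrite linear0; apply: inner_eq0.
by rewrite {1}linearB gDl gNl uv subrr.
Qed.

Let L_row_sum u w : g (L u) w = \sum_j u 0 j * g (L 'e_j) w.
Proof.
by apply: (@scalar_row_sum _ _ (fun u => g (L u) w)) => a x y; rewrite linearP gPl.
Qed.

(** The Gram matrix of the pulled back inner product is invertible since the product is definite. *)
Lemma riesz w : exists z, forall u, g (L z) (L u) = g w (L u).
Proof.
pose G := \matrix_(i < m, j < m) g (L 'e_i) (L 'e_j).
have GE u j : (u *m G) 0 j = g (L u) (L 'e_j).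
  by rewrite mxE L_row_sum; apply: eq_bigr => i _; rewrite mxE.
have ext u v : (forall j, g u (L 'e_j) = g v (L 'e_j)) ->
    forall x, g u (L x) = g v (L x).
  move=> uv x; rewrite !(g_sym _ (L x)) !L_row_sum.
  by apply: eq_bigr => j _; rewrite !(g_sym (L _)) uv.
have uG : G \in unitmx.
  rewrite -row_free_unit; apply/inj_row_free => v vG.
  apply: pullback_nondeg => x; rewrite linear0 g0l -(g0l (L x)).
  by apply: ext => j; rewrite g0l -GE vG mxE.
exists ((\row_j g w (L 'e_j)) *m invmx G).
by apply: ext => j; rewrite -GE mulmxKV // mxE.
Qed.

Lemma invariant_matrix : exists J : 'M[R]_m, forall u, L (u *m J) = phi (L u).
Proof.
pose J := \matrix_(i < m) projT1 (cid (L_inv 'e_i)).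
exists J => u; rewrite mulmx_sum_row linear_sum.
rewrite [in RHS](linear_row_sum L u) linear_sum; apply: eq_bigr => i _.
by rewrite !linearZ rowK; case: cid => w /= ->.
Qed.

(** Here [z1], [z2] are the projections of [Z1], [Z2] to the image of [L], and [p], [q], [s] the entries
    of their Gram matrix.  With [J] the endomorphism of the source of [L] induced by [phi] and [Q] the
    projection to its kernel, [(J + Q)^2 = -(1 - 2 Q)], and [1 - 2 Q] has determinant [1] or [-1]
    according to the rank of the Gram matrix; as a square has a nonnegative determinant, this rank
    has the parity of [m]. *)
Lemma invariant_subspace : exists z1 z2 p q s,
  [/\ forall u, g (L z1) (L u) = g Z1 (L u),
      forall u, g (L z2) (L u) = g Z2 (L u),
      L z1 = p *: Z1 + q *: Z2, L z2 = q *: Z1 + s *: Z2 &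
      [/\ [\/ [/\ ~~ odd m, p = 0, q = 0 & s = 0],
              [/\ ~~ odd m, p = 1, q = 0 & s = 1] |
              [/\ odd m, p + s = 1 & p * s = q ^+ 2]],
          p = p ^+ 2 + q ^+ 2, s = s ^+ 2 + q ^+ 2 &
          (forall u, phi (L u) = 0) -> p + s = m%:R]].
Proof.
have [z1 z1E] := riesz Z1; have [z2 z2E] := riesz Z2.
have [J JE] := invariant_matrix.
pose p := g (L z1) Z1; pose q := g (L z1) Z2; pose s := g (L z2) Z2.
have q' : g (L z2) Z1 = q by rewrite g_sym -z1E g_sym z2E g_sym.
have zJ Z z : (forall u, g (L z) (L u) = g Z (L u)) -> phi Z = 0 -> z *m J = 0.
  move=> zE Z0.
  apply: pullback_nondeg => w; rewrite linear0 g0l JE g_sym phi_skew -JE zE JE.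
  by rewrite phi_skew Z0 (g_sym _ 0) g0l !oppr0.
have z1J := zJ _ _ z1E phi_Z1; have z2J := zJ _ _ z2E phi_Z2.
have kerE u : phi (L u) = 0 -> L u = g (L u) Z1 *: Z1 + g (L u) Z2 *: Z2.
  move=> pu; have := phi_sqr (L u); rewrite pu linear0 -addrA.
  by move/eqP; rewrite eq_sym addrC subr_eq0 => /eqP.
have Lz1 : L z1 = p *: Z1 + q *: Z2 by rewrite kerE // -JE z1J linear0.
have Lz2 : L z2 = q *: Z1 + s *: Z2 by rewrite kerE ?q' // -JE z2J linear0.
have gZ21 : g Z2 Z1 = 0 by rewrite g_sym.
have Ep : p = p ^+ 2 + q ^+ 2.
  transitivity (g (L z1) (L z1)); first by rewrite z1E g_sym.
  by rewrite [X in g _ X]Lz1 gDr !gZr -/p -/q; ring.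
have Es : s = s ^+ 2 + q ^+ 2.
  transitivity (g (L z2) (L z2)); first by rewrite z2E g_sym.
  by rewrite [X in g _ X]Lz2 gDr !gZr -/s q'; ring.
have Eq : q = q * (p + s).
  transitivity (g (L z2) (L z1)); first by rewrite z2E g_sym.
  by rewrite [X in g _ X]Lz1 gDr !gZr -/s q'; ring.
pose b1 := \col_j g (L 'e_j) Z1; pose b2 := \col_j g (L 'e_j) Z2.
pose B := row_mx b1 b2; pose Z := col_mx z1 z2.
have bE u : (u *m b1 = (g (L u) Z1)%:M) * (u *m b2 = (g (L u) Z2)%:M).
  split; apply/matrixP => i j; rewrite !ord1 !mxE eqxx mulr1n L_row_sum;
    by apply: eq_bigr => k _; rewrite mxE.
have uBZ u : u *m (B *m Z) = g (L u) Z1 *: z1 + g (L u) Z2 *: z2.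
  by rewrite mul_row_col mulmxDr !mulmxA !bE !mul_scalar_mx.
have ZB : Z *m B = block_mx (p%:M) (q%:M) (q%:M) (s%:M).
  by rewrite mul_col_row !bE q'.
have JJ : J *m J = - 1%:M + B *m Z.
  apply/row_matrixP => i; rewrite !rowE.
  set u := delta_mx 0 i; rewrite mulmxDr mulmxN mulmx1 uBZ.
  suff : u + u *m J *m J = g (L u) Z1 *: z1 + g (L u) Z2 *: z2.
    by rewrite mulmxA => <-; rewrite addKr.
  apply: pullback_nondeg => w.
  rewrite !linearD !linearZ !gDl !gZl z1E z2E !JE phi_sqr !gDl gNl !gZl.
  by rewrite addrA addNKr.
have Jb Z' : phi Z' = 0 -> J *m (\col_j g (L 'e_j) Z') = 0.
  move=> Z0; apply/colP => i; rewrite [RHS]mxE.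
  have -> : (J *m \col_j g (L 'e_j) Z') i 0 = g (L ('e_i *m J)) Z'.
    rewrite -rowE L_row_sum mxE; apply: eq_bigr => j _; by rewrite !mxE.
  by rewrite JE g_sym phi_skew Z0 g_sym g0l oppr0.
(* In the row vector convention [B *m Z] is the projection [Q] to the span of [z1], [z2] and [Z *m B]
   is the Gram matrix [P]; the next identities are [J Q = Q J = 0] and [Q^2 = Q]. *)
have JB : J *m B = 0 by rewrite mul_mx_row /b1 /b2 !Jb // row_mx0.
have ZJ : Z *m J = 0 by rewrite mul_col_mx z1J z2J col_mx0.
have ZBZ : Z *m B *m Z = Z.
  rewrite ZB mul_block_col !mul_scalar_mx; congr col_mx; apply: L_inj;
    rewrite linearD !linearZ /= Lz1 Lz2 !scalerDr !scalerA addrACA -!scalerDl;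
    congr (_ *: _ + _ *: _).
  - by rewrite [RHS]Ep !expr2.
  - by rewrite [RHS]Eq; ring.
  - by rewrite [RHS]Eq; ring.
  - by rewrite [RHS]Es; ring.
(* This is the identity [(J + Q)^2 = -(1 - 2 Q)], whose determinant decides the parity. *)
have sqr : (J + B *m Z) *m (J + B *m Z) = - (1%:M - B *m (2%:R *: Z)).
  rewrite mulmxDl !mulmxDr JJ -[B *m Z *m J]mulmxA ZJ mulmx0 add0r.
  rewrite [J *m _]mulmxA JB mul0mx addr0 -[B *m Z *m _]mulmxA [Z *m _]mulmxA ZBZ.
  by rewrite -scalemxAr opprB -addrA -mulr2n scaler_nat addrC.
have det2 : \det (1%:M - B *m (2%:R *: Z)) = 1 - 2 * (p + s) + 4 * (p * s - q ^+ 2).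
  rewrite det_1B_mulC -scalemxAl ZB scale_block_mx -[1%:M]/((1%:M : 'M[R]_(1 + 1))).
  rewrite scalar_mx_block opp_block_mx add_block_mx !add0r !scale_scalar_mx.
  by rewrite -!raddfN /= -!raddfD /= det_block_scalar; ring.
have detE : \det (J + B *m Z) ^+ 2 =
    (-1) ^+ m * (1 - 2 * (p + s) + 4 * (p * s - q ^+ 2)).
  by rewrite expr2 -det_mulmx sqr -scaleN1r detZ det2.
have /= := sqr_ge0 (\det (J + B *m Z)); rewrite detE -signr_odd => det_ge0.
exists z1, z2, p, q, s; split => //; split => //.
  case: (symmetric_idempotent2 Ep Eq Es) => [[p0 q0 s0]|[p0 q0 s0]|[ps1 ps2]].
  - apply: Or31; split=> //; apply/negP => mo.
    by move: det_ge0; rewrite p0 q0 s0 mo expr1; lra.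
  - apply: Or32; split=> //; apply/negP => mo.
    by move: det_ge0; rewrite p0 q0 s0 mo expr1; lra.
  - apply: Or33; split=> //; apply/negPn/negP => /negbTE mo.
    by move: det_ge0; rewrite ps1 ps2 mo expr0; lra.
move=> phiL0; have J0 : J = 0.
  apply/row_matrixP => i; rewrite row0 rowE; apply: L_inj.
  by rewrite JE phiL0 linear0.
have := mxtrace1 R m.
have <- : B *m Z = 1%:M.
  by apply/eqP; rewrite -subr_eq0 addrC -JJ J0 mul0mx.
by rewrite mxtrace_mulC ZB mxtrace_block !mxtrace_scalar !mulr1n.
Qed.

End InvariantSubspace.

(** * Continuity of the determinant and locally constant functions *)

Lemma cvg_det (R : realType) (T : Type) (F : set_system T) (FF : Filter F) m
    (A : T -> 'M[R]_m) (B : 'M[R]_m) :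
  (forall i j, A x i j @[x --> F] --> B i j) -> \det (A x) @[x --> F] --> \det B.
Proof.
move=> AB; rewrite /determinant.
apply: cvg_big => [|s _]; first exact: add_continuous.
apply: cvgM; first exact: cvg_cst.
by apply: cvg_big => [|i _]; [exact: mul_continuous | exact: AB].
Qed.

(** The level sets of [h] are open, so each of them is closed as well. *)
Lemma connected_locally_constant (T : topologicalType) (X : Type) (h : T -> X) :
  connected [set: T] -> (forall x, \forall y \near x, h y = h x) ->
  forall x y, h x = h y.
Proof.
move=> cT hl x y; pose B := [set z | h z = h x].
have BT : B = setT.
  have oB : open B.
    by rewrite openE => z zB; apply: filterS (hl z) => w; rewrite /B /= => ->.
  have cB : closed B.
    rewrite -openC openE => z zB; apply: filterS (hl z) => w.
    by rewrite /B /= => ->.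
  by apply: cT; [exists x | exists B; rewrite ?setTI | exists B; rewrite ?setTI].
by have : B y by rewrite BT.
Qed.

(** * Charts and coordinate changes *)

Lemma chart_invK (R : realType) n (M : topologicalType) (c : chart R n M) p :
  cdom c p -> cinv c (c p) = p.
Proof. by move=> cp; apply: cfunK; rewrite inE. Qed.

Lemma compatible_diff (R : realType) n (M : topologicalType) (c c' : chart R n M) p :
  compatible c c' -> cdom c p -> cdom c' p ->
  differentiable (c' \o cinv c) (c p).
Proof. by move=> [/(_ 1%N)[d _] _] cp c'p; apply: d; exists p. Qed.

Section Charts.
Variables (R : realType) (m n : nat) (N M : topologicalType) (f : N -> M).
Hypothesis f_cont : continuous f.
Implicit Types (c : chart R m N) (C : chart R n M).

Definition local_rep c C : 'rV[R]_m -> 'rV[R]_n := C \o f \o cinv c.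

(** The part of the chart image where [local_rep] expresses [f]. *)
Definition local_dom c C : set 'rV[R]_m := c @` (cdom c `&` f @^-1` cdom C).

Lemma local_dom_img c C z : local_dom c C z ->
  [/\ cdom c (cinv c z), c (cinv c z) = z & cdom C (f (cinv c z))].
Proof. by move=> [p [cp Cp] <-]; rewrite chart_invK. Qed.

Lemma open_local_dom c C : open (local_dom c C).
Proof.
rewrite openE => _ [p [cp Cp] <-].
have ip : cimg c (c p) by exists p.
have H1 : \forall x \near c p, cimg c x.
  by apply: open_nbhs_nbhs; split => //; exact: cimg_open.
have H2 : \forall x \near c p, cdom C (f (cinv c x)).
  have : nbhs (cinv c (c p)) (f @^-1` cdom C).
    rewrite chart_invK //; apply: f_cont.
    by apply: open_nbhs_nbhs; split => //; exact: cdom_open.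
  exact: cinv_continuous.
apply: filterS2 H1 H2 => x [q cq <-]; rewrite chart_invK // => Cq.
by exists q.
Qed.

(** [C'] is an arbitrary chart with a differentiable transition map, so that the lemma serves for
    foliated charts, which need not belong to the atlas. *)
Lemma local_rep_change_target c C (C' : chart R n M) x :
  cdom c x -> cdom C (f x) ->
  differentiable (local_rep c C) (c x) ->
  differentiable (C' \o cinv C) (C (f x)) ->
  differentiable (local_rep c C') (c x) /\
  forall v, 'd (local_rep c C') (c x) v =
    'd (C' \o cinv C) (C (f x)) ('d (local_rep c C) (c x) v).
Proof.
move=> cx Cx dl dC.
have lx : local_dom c C (c x) by exists x.
have lE : local_rep c C (c x) = C (f x) by rewrite /local_rep /= chart_invK.
have E : \forall z \near c x,
    ((C' \o cinv C) \o local_rep c C) z = local_rep c C' z.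
  apply: filterS (open_nbhs_nbhs (conj (@open_local_dom c C) lx)).
  move=> z /local_dom_img[_ _ Cz].
  by rewrite /local_rep /= chart_invK.
have dC' : differentiable (C' \o cinv C) (local_rep c C (c x)) by rewrite lE.
have dcomp := differentiable_comp dl dC'.
split; first exact: near_eq_differentiable E dcomp.
move=> v; apply: etrans (esym (congr1 (fun h => h v) (near_eq_diff E dcomp))) _.
by apply: etrans (diff_comp_apply v dl dC') _; rewrite lE.
Qed.

End Charts.

Section ChartChange.
Variables (R : realType) (m n : nat) (N M : topologicalType) (f : N -> M).
Implicit Types (c : chart R m N) (C : chart R n M).

Lemma local_rep_change_source c c' C x : cdom c x -> cdom c' x ->
  differentiable (local_rep f c C) (c x) ->
  differentiable (c \o cinv c') (c' x) ->
  forall v, 'd (local_rep f c' C) (c' x) v =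
    'd (local_rep f c C) (c x) ('d (c \o cinv c') (c' x) v).
Proof.
move=> cx c'x dl dc.
have lx : local_dom id c' c (c' x) by exists x.
have lE : (c \o cinv c') (c' x) = c x by rewrite /= chart_invK.
have E : \forall z \near c' x,
    (local_rep f c C \o (c \o cinv c')) z = local_rep f c' C z.
  have oD := @open_local_dom R m m N N id (fun x => cvg_id) c' c.
  apply: filterS (open_nbhs_nbhs (conj oD lx)) => z /local_dom_img[_ _ cz].
  by rewrite /local_rep /= chart_invK.
have dl' : differentiable (local_rep f c C) ((c \o cinv c') (c' x)) by rewrite lE.
have dcomp := differentiable_comp dc dl'.
move=> v; apply: etrans (esym (congr1 (fun h => h v) (near_eq_diff E dcomp))) _.
by apply: etrans (diff_comp_apply v dc dl') _; rewrite lE.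
Qed.

Lemma chart_changeK c c' x : cdom c x -> cdom c' x ->
  differentiable (c' \o cinv c) (c x) -> differentiable (c \o cinv c') (c' x) ->
  forall v, 'd (c' \o cinv c) (c x) ('d (c \o cinv c') (c' x) v) = v.
Proof.
move=> cx c'x d1 d2 v.
have lx : local_dom id c' c (c' x) by exists x.
have lE : (c \o cinv c') (c' x) = c x by rewrite /= chart_invK.
have E : \forall z \near c' x, ((c' \o cinv c) \o (c \o cinv c')) z = id z.
  have oD := @open_local_dom R m m N N id (fun x => cvg_id) c' c.
  apply: filterS (open_nbhs_nbhs (conj oD lx)) => z /local_dom_img[_ zE cz].
  by rewrite /= chart_invK.
have d1' : differentiable (c' \o cinv c) ((c \o cinv c') (c' x)) by rewrite lE.
have dcomp := differentiable_comp d2 d1'.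
rewrite -[in LHS]lE; apply: etrans (esym (diff_comp_apply v d2 d1')) _.
apply: etrans (congr1 (fun h => h v) (near_eq_diff E dcomp)) _.
by rewrite diff_val.
Qed.

Lemma local_repE c C x : cdom c x -> local_rep f c C (c x) = C (f x).
Proof. by move=> cx; rewrite /local_rep /= chart_invK. Qed.

End ChartChange.

(** * Pulling back forms to a submanifold *)

Section FormsOnManifold.
Variables (R : realType) (n : nat) (M : manifold R n).
Variable a : M -> {scalar 'rV[R]_n}.
Hypothesis a_smooth : smooth_form a.

Lemma local_form_scalar c x : scalar (fun w => local_form a c w x).
Proof. by move=> k u v; rewrite /local_form /tvec linearP linearP. Qed.

Lemma local_form_diff c p v : atlas M c -> cdom c p ->
  differentiable (local_form a c v) (c p).
Proof. by move=> ac cp; have [d _] := a_smooth v ac 1%N; apply: d; exists p. Qed.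

Lemma dformC p u v : dform a p u v = - dform a p v u.
Proof. by rewrite /dform -mulrN opprB. Qed.

Lemma dform_ext_d p u v : dform a p u v = 2^-1 *
  ext_d (fun x w => local_form a (chart_at M p) w x) (chart_at M p p) u v.
Proof. by []. Qed.

Lemma dform_linear_comb p s u v w :
  dform a p (s *: u + v) w = s * dform a p u w + dform a p v w.
Proof.
have d v' := local_form_diff v' (atlas_chart_at p) (cdom_chart_at p).
have E : local_form a (chart_at M p) (s *: u + v) =
    s *: local_form a (chart_at M p) u + local_form a (chart_at M p) v.
  by apply/funext => x; exact: local_form_scalar.
have E1 := derive_linear_comb s u v (d w).
have E2 : 'D_w (local_form a (chart_at M p) (s *: u + v)) (chart_at M p p) =
    s * 'D_w (local_form a (chart_at M p) u) (chart_at M p p) +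
    'D_w (local_form a (chart_at M p) v) (chart_at M p p).
  rewrite E deriveD; last 2 first.
  - by apply: derivableZ; apply: diff_derivable.
  - by apply: diff_derivable.
  by rewrite deriveZ //; apply: diff_derivable.
rewrite /dform E1 E2 /=; set X := 'D_u _ _; set Y := 'D_v _ _.
set X' := 'D_w _ _; set Y' := 'D_w _ _; clearbody X Y X' Y'.
by rewrite -[s *: X]/(s * X); ring.
Qed.

End FormsOnManifold.

Section FormsOnSubmanifold.
Variables (R : realType) (m n : nat) (N : manifold R m) (M : manifold R n).
Variable f : N -> M.
Hypothesis f_smooth : smooth_map f.
Implicit Types (c : chart R m N) (C : chart R n M) (y : N).

(** The differential of [f] read in the chart [c] of [N] and in the distinguished chart at [f y],
    in which the tangent vectors of [M] at [f y] are represented. *)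
Definition local_diff c y : {linear 'rV[R]_m -> 'rV[R]_n} :=
  'd (local_rep f c (chart_at M (f y))) (c y).

Lemma local_rep_diff c C y : atlas N c -> atlas M C -> cdom c y ->
  cdom C (f y) -> differentiable (local_rep f c C) (c y).
Proof.
by move=> ac aC cy Cy; have [d _] := f_smooth.2 _ _ ac aC 1%N; apply: d; exists y.
Qed.

Lemma local_diff_target c C y : atlas N c -> cdom c y -> cdom C (f y) ->
  compatible (chart_at M (f y)) C ->
  differentiable (local_rep f c C) (c y) /\
  forall v, 'd (local_rep f c C) (c y) v = coords C (f y) (local_diff c y v).
Proof.
move=> ac cy Cy comp; have Ky := cdom_chart_at (f y).
apply: (local_rep_change_target f_smooth.1 cy Ky).
  exact: local_rep_diff (atlas_chart_at _) cy Ky.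
exact: compatible_diff comp Ky Cy.
Qed.

Lemma local_diff_tvec c C y v : atlas N c -> atlas M C -> cdom c y ->
  cdom C (f y) ->
  local_diff c y v = tvec C (f y) ('d (local_rep f c C) (c y) v).
Proof.
move=> ac aC cy Cy; have Ky := cdom_chart_at (f y).
have d1 := local_rep_diff ac aC cy Cy.
have d2 := compatible_diff (atlas_compatible aC (atlas_chart_at (f y))) Cy Ky.
by have [_ H] := local_rep_change_target f_smooth.1 cy Cy d1 d2; exact: H.
Qed.

Lemma local_diff_source c y v : atlas N c -> cdom c y ->
  local_diff c y v = tangent_map f y (tvec c y v).
Proof.
move=> ac cy; have cy' := cdom_chart_at y.
have aK := atlas_chart_at y.
apply: (local_rep_change_source cy' cy).
  exact: local_rep_diff (atlas_chart_at _) _ (cdom_chart_at _).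
exact: compatible_diff (atlas_compatible ac aK) cy cy'.
Qed.

Lemma tvecK c y : atlas N c -> cdom c y ->
  cancel (tvec c y) (coords c y) /\ cancel (coords c y) (tvec c y).
Proof.
move=> ac cy; have cy' := cdom_chart_at y; have aK := atlas_chart_at y.
have d1 := compatible_diff (atlas_compatible ac aK) cy cy'.
have d2 := compatible_diff (atlas_compatible aK ac) cy' cy.
by split=> v; apply: chart_changeK.
Qed.

Lemma local_diff_range c y : atlas N c -> cdom c y ->
  range (local_diff c y) = tangent_space f y.
Proof.
move=> ac cy; have [K1 K2] := tvecK ac cy; apply/seteqP; split=> _ [v _ <-].
  by rewrite local_diff_source //; exists (tvec c y v).
by exists (coords c y v) => //; rewrite local_diff_source // K2.
Qed.

Lemma local_diff_inj c y : atlas N c -> cdom c y ->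
  injective (tangent_map f y) -> injective (local_diff c y).
Proof.
move=> ac cy inj u v; rewrite !local_diff_source // => /inj.
by have [K1 _] := tvecK ac cy => /(can_inj K1).
Qed.

Section Pullback.
Variable a : M -> {scalar 'rV[R]_n}.
Hypothesis a_smooth : smooth_form a.

(** The form [f^* a] in the chart [c].  The distinguished chart of [M] used in [local_diff] varies
    with the point without any continuity; [pulled_formE] trades it for a fixed chart. *)
Definition pulled_form c (z v : 'rV[R]_m) : R^o :=
  a (f (cinv c z)) (local_diff c (cinv c z) v).

Lemma pulled_form_chart c y v : cdom c y ->
  pulled_form c (c y) v = a (f y) (local_diff c y v).
Proof. by move=> cy; rewrite /pulled_form chart_invK. Qed.

Lemma pulled_formE c C z v : atlas N c -> atlas M C -> local_dom f c C z ->
  pulled_form c z v =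
  local_form a C ('D_v (local_rep f c C) z) (local_rep f c C z).
Proof.
move=> ac aC [y [cy Cy] <-]; rewrite /pulled_form chart_invK //.
rewrite deriveE; last exact: local_rep_diff.
apply: etrans (congr1 (a (f y)) (local_diff_tvec v ac aC cy Cy)) _.
by rewrite (local_repE f C cy) /local_form (chart_invK Cy).
Qed.

Lemma pulled_form_Ck2 c C v : atlas N c -> atlas M C ->
  Ck_on 2 (local_dom f c C) (pulled_form c ^~ v).
Proof.
move=> ac aC; have oD := @open_local_dom R m n N M f f_smooth.1 c C.
have CF k : Ck_on k (local_dom f c C) (local_rep f c C).
  exact: (f_smooth.2 _ _ ac aC k).
apply: (@Ck_on_eq _ _ _ _ _ (fun z => \sum_j ('D_v (local_rep f c C) z 0 j *
  local_form a C 'e_j (local_rep f c C z) : R^o))) => //.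
  move=> z Dz; rewrite (pulled_formE v ac aC Dz).
  exact: esym (scalar_row_sum _ (local_form_scalar a C (local_rep f c C z))).
apply: Ck_on_sum => // j; apply: Ck_on_mul => //.
  by apply: Ck_on_coord => //; exact: (CF 3%N).2.
apply: (@Ck_on_comp _ _ _ _ _ (local_rep f c C) (cimg C)) => //.
- exact: cimg_open.
- move=> z Dz; have [_ _ Cz] := local_dom_img Dz.
  by exists (f (cinv c z)).
- exact: a_smooth.
Qed.

(** [dform] is computed in the distinguished chart at the point itself; near [y] the pulled back form
    is the pull-back from that fixed chart, to which [ext_d_pullback] applies.  The factor [2] comes
    from the convention of [dform]. *)
Lemma ext_d_pulled_form c y u v : atlas N c -> cdom c y ->
  ext_d (pulled_form c) (c y) u v =
  2 * dform a (f y) (local_diff c y u) (local_diff c y v).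
Proof.
move=> ac cy; pose K := chart_at M (f y).
have aK : atlas M K by exact: atlas_chart_at.
have Ky : cdom K (f y) by exact: cdom_chart_at.
have oD := @open_local_dom R m n N M f f_smooth.1 c K.
have Dy : local_dom f c K (c y) by exists y.
have FE := local_repE f K cy.
have E : \forall z \near c y, pulled_form c z =1
    (fun w => local_form a K ('D_w (local_rep f c K) z) (local_rep f c K z)).
  apply: filterS (open_nbhs_nbhs (conj oD Dy)) => z Dz w.
  exact: pulled_formE.
have dl := local_rep_diff ac aK cy Ky.
have dA w : differentiable (local_form a K w) (local_rep f c K (c y)).
  by rewrite FE; exact: local_form_diff.
rewrite (near_eq_ext_d u v E).
have := @ext_d_pullback R _ n (fun x w => local_form a K w x) (local_rep f c K)
  (local_dom f c K) (c y) u v oD Dy (f_smooth.2 _ _ ac aK 2%N)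
  (fun x => local_form_scalar a K x) dA.
move=> H; apply: etrans H _.
by rewrite FE dform_ext_d mulrA divff ?pnatr_eq0 // mul1r !deriveE.
Qed.

End Pullback.
End FormsOnSubmanifold.

(** * Submanifolds tangent to a foliation *)

Lemma compatible_sym (R : realType) n (M : topologicalType) (c c' : chart R n M) :
  compatible c c' -> compatible c' c.
Proof. by rewrite /compatible setIC => -[h1 h2]; split. Qed.

Section TangentSubmanifold.
Variables (R : realType) (d q m : nat) (M : manifold R (d + q)).
Variables (F : foliation M) (D : M -> set 'rV[R]_(d + q)).
Variables (N : manifold R m) (f : N -> M).
Hypothesis f_smooth : smooth_map f.
Hypothesis F_tangent : foliation_tangent_to F D.
Hypothesis f_tangent : forall x u, tangent_space f x u -> D (f x) u.

(** Along [f] the differential of the transverse coordinates of a foliated chart vanishes, so they are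
    constant on a ball in a chart of [N]. *)
Lemma tangent_submanifold_near x : \forall y \near x, same_plaque F (f x) (f y).
Proof.
pose c := chart_at N x.
have ac : atlas N c by exact: atlas_chart_at.
have cx : cdom c x by exact: cdom_chart_at.
have [C FC Cx] := fatlas_cover F (f x).
have D0 : local_dom f c C (c x) by exists x.
have oD := @open_local_dom R m (d + q) N M f f_smooth.1 c C.
have /nbhs_ballP[e /= e0 He] : nbhs (c x) (local_dom f c C).
  exact: (open_nbhs_nbhs (conj oD D0)).
have transverse_cst z : ball (c x) e z ->
    rsubmx (local_rep f c C z) = rsubmx (local_rep f c C (c x)).
  move=> Bz; apply/rowP => j; rewrite !mxE.
  apply: (@derive0_ball_cst _ _ (fun z => local_rep f c C z 0 (rshift d j) : R^o)
    (c x) e _ z Bz) => _ v /He[y [cy Cy] <-].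
  have comp : compatible (chart_at M (f y)) C.
    by apply: compatible_sym; exact: (fatlas_smooth FC (atlas_chart_at _)).
  have [dl lE] := local_diff_target f_smooth ac cy Cy comp.
  split.
    apply: diff_derivable.
    apply: (@differentiable_comp _ _ _ _ (local_rep f c C)
      (fun u : 'rV[R]_(d + q) => u 0 (rshift d j) : R^o)) => //.
    exact: differentiable_coord.
  rewrite -(derive_coord v (rshift d j) dl) deriveE // lE.
  have : rsubmx (coords C (f y) (local_diff f c y v)) = 0.
    apply/(F_tangent FC Cy); apply: f_tangent.
    have Lr := local_diff_range f_smooth ac cy.
    have : range (local_diff f c y) (local_diff f c y v) by exact: (imageT (local_diff f c y) v).
    by rewrite Lr.
  by move/rowP => /(_ j); rewrite !mxE.
have near_y : \forall y \near x, ball (c x) e (c y).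
  by have := cfun_continuous cx (nbhsx_ballx (c x) _ e0).
apply: filterS2 near_y (open_nbhs_nbhs (conj (cdom_open c) cx)) => y By cy.
have [_ _] := local_dom_img (He _ By); rewrite (chart_invK cy) => Cy.
exists C; split => //.
by have := transverse_cst _ By; rewrite !(local_repE f C) //; exact: esym.
Qed.

(** The leaf through [f x] is locally constant in [x]. *)
Lemma tangent_submanifold_in_leaf : [set: N] !=set0 -> connected [set: N] ->
  exists2 L, is_leaf F L & range f `<=` L.
Proof.
move=> [x0 _] cN.
pose leaf x : set M := [set y | clos_refl_trans M (same_plaque F) (f x) y].
have plaque_sym u v : same_plaque F u v -> same_plaque F v u.
  by move=> [c [Fc cu cv uv]]; exists c.
have leaf_cst x y : leaf x = leaf y.
  apply: (connected_locally_constant cN) => {}x.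
  apply: filterS (tangent_submanifold_near x) => {}y xy.
  apply/seteqP; split=> w; apply: rt_trans; apply: rt_step => //.
  exact: plaque_sym.
exists (leaf x0); first by exists (f x0).
by move=> _ [y _ <-]; rewrite (leaf_cst x0 y); exact: rt_refl.
Qed.

End TangentSubmanifold.

(** * Invariant submanifolds of a metric contact pair *)

Fact ratio_eq (R : fieldType) (b b' p q : R) :
  b != 0 -> p != 0 -> p * b' = q * b -> b' / b = q / p.
Proof. by move=> b0 p0 E; apply/eqP; rewrite eqr_div // mulrC E. Qed.

Fact ratio_cross (R : fieldType) (b b' c c' p q : R) :
  p != 0 -> p * b' = q * b -> p * c' = q * c -> b' * c = c' * b.
Proof.
by move=> p0 Eb Ec; apply: (mulfI p0); rewrite !mulrA Eb Ec mulrAC.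
Qed.

Fact eq_inv_ratio (R : realFieldType) (p q : R) :
  p != 0 -> p = p ^+ 2 + q ^+ 2 -> p = (1 + (q / p) ^+ 2)^-1.
Proof.
move=> p0 E; have -> : 1 + (q / p) ^+ 2 = p^-1; last by rewrite invrK.
have -> : 1 + (q / p) ^+ 2 = (p ^+ 2 + q ^+ 2) / p ^+ 2 by field.
by rewrite -E expr2 invfM mulrA divff // mul1r.
Qed.

Fact complement_eq (R : comPzRingType) (p q s x y : R) :
  q * x + s * y = y -> s + p = 1 -> p * y = q * x.
Proof. by move=> E E1; apply: (addIr (s * y)); rewrite E -mulrDl addrC E1 mul1r. Qed.

Lemma row1_colinear (R : fieldType) m (w z : 'rV[R]_m) :
  m = 1%N -> z != 0 -> exists t, w = t *: z.
Proof.
move=> m1; subst m => z0.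
have z00 : z 0 0 != 0.
  by apply: contra z0 => /eqP z00; apply/eqP/rowP => i; rewrite ord1 z00 mxE.
by exists (w 0 0 / z 0 0); apply/rowP => i; rewrite ord1 mxE divfK.
Qed.

Section InvariantSubmanifold.
Variables (R : realType) (h k m : nat).
Local Notation n := (2 + (2 * h + 2 * k))%N.
Variables (N : manifold R m) (M : manifold R n).
Variables (f : N -> M) (a1 a2 : M -> {scalar 'rV[R]_n}) (Z1 Z2 : M -> 'rV[R]_n)
  (phi : M -> {linear 'rV[R]_n -> 'rV[R]_n})
  (g : M -> 'rV[R]_n -> 'rV[R]_n -> R).
Hypothesis mcp : metric_contact_pair a1 a2 Z1 Z2 phi g.
Hypothesis f_sub : submanifold f.
Hypothesis f_inv : phi_invariant f phi.

Let cps := mcp_structure mcp.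
Let reeb := cps_reeb cps.
Let a1_smooth : smooth_form a1 := contact_smooth1 (cps_pair cps).
Let a2_smooth : smooth_form a2 := contact_smooth2 (cps_pair cps).
Let g_metric : riemannian_metric g := mcp_metric mcp.
Let a1Z1 p : a1 p (Z1 p) = 1 := reeb_a1Z1 reeb p.
Let a2Z1 p : a2 p (Z1 p) = 0 := reeb_a2Z1 reeb p.
Let a1Z2 p : a1 p (Z2 p) = 0 := reeb_a1Z2 reeb p.
Let a2Z2 p : a2 p (Z2 p) = 1 := reeb_a2Z2 reeb p.
Let d1Z1 p u : dform a1 p (Z1 p) u = 0 := reeb_d1Z1 reeb p u.
Let d1Z2 p u : dform a1 p (Z2 p) u = 0 := reeb_d1Z2 reeb p u.
Let d2Z1 p u : dform a2 p (Z1 p) u = 0 := reeb_d2Z1 reeb p u.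
Let d2Z2 p u : dform a2 p (Z2 p) u = 0 := reeb_d2Z2 reeb p u.
Let phi_sqr p u : phi p (phi p u) = - u + a1 p u *: Z1 p + a2 p u *: Z2 p :=
  cps_sqr cps p u.
Let phiZ1 p : phi p (Z1 p) = 0 := cps_Z1 cps p.
Let phiZ2 p : phi p (Z2 p) = 0 := cps_Z2 cps p.
Let g_phi p u v : g p u (phi p v) = dform a1 p u v + dform a2 p u v :=
  mcp_phi mcp p u v.
Let gZ1 p u : g p u (Z1 p) = a1 p u := mcp_Z1 mcp p u.
Let gZ2 p u : g p u (Z2 p) = a2 p u := mcp_Z2 mcp p u.
Let f_smooth : smooth_map f := submanifold_smooth f_sub.

Definition reeb_tan1 x := tangent_part g (f x) (tangent_space f x) (Z1 (f x)).
Definition reeb_tan2 x := tangent_part g (f x) (tangent_space f x) (Z2 (f x)).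
(** The Gram matrix of the tangential parts of [Z1], [Z2]: since [ai] is the inner product with [Zi],
    [ai (reeb_tanj x)] is the inner product of the two tangential parts. *)
Definition gram11 x := a1 (f x) (reeb_tan1 x).
Definition gram12 x := a2 (f x) (reeb_tan1 x).
Definition gram22 x := a2 (f x) (reeb_tan2 x).

Lemma phi_skew p u v : g p u (phi p v) = - g p v (phi p u).
Proof. by rewrite !g_phi dformC (dformC a2) opprD. Qed.

Let metric_sub p u v w : g p (u - v) w = g p u w - g p v w.
Proof.
have gl := metric_linear g_metric p w.
have /= E := gl (-1) v u.
by rewrite -[- v]scaleN1r [u + _]addrC E mulN1r addrC.
Qed.

Lemma tangent_partE p (L : {linear 'rV[R]_m -> 'rV[R]_n}) z Z :
  (forall u, g p (L z) (L u) = g p Z (L u)) ->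
  tangent_part g p (range L) Z = L z.
Proof.
move=> zE; rewrite /tangent_part.
set P := (X in get X).
have Pz : P (L z) by split; [exists z | move=> _ [u _ <-]; rewrite metric_sub zE subrr].
have [[w _ wE] Pw] := @getPex _ P (ex_intro _ _ Pz).
rewrite -[LHS]/(get P) -wE; apply/eqP; rewrite -subr_eq0; apply/eqP.
apply: (inner_eq0 (metric_pos g_metric p)).
have E u : g p (L w) (L u) = g p (L z) (L u).
  have := Pw (L u) (ex_intro2 _ _ u I erefl); rewrite -wE metric_sub => /eqP.
  by rewrite subr_eq0 -zE => /eqP.
by rewrite metric_sub -linearB E subrr.
Qed.

(** [L] is any parametrisation of the tangent space, so that the lemma serves in every chart of [N],
    whereas the coefficients depend on the point only. *)
Lemma projection_coordinates x (L : {linear 'rV[R]_m -> 'rV[R]_n}) :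
  injective L -> range L = tangent_space f x ->
  let p := gram11 x in let q := gram12 x in let s := gram22 x in
  exists z1 z2,
  [/\ reeb_tan1 x = L z1 /\ reeb_tan2 x = L z2,
      L z1 = p *: Z1 (f x) + q *: Z2 (f x),
      L z2 = q *: Z1 (f x) + s *: Z2 (f x),
      (forall u, g (f x) (L z1) (L u) = a1 (f x) (L u)) /\
      (forall u, g (f x) (L z2) (L u) = a2 (f x) (L u)) &
      [/\ [\/ [/\ ~~ odd m, p = 0, q = 0 & s = 0],
              [/\ ~~ odd m, p = 1, q = 0 & s = 1] |
              [/\ odd m, p + s = 1 & p * s = q ^+ 2]],
          p = p ^+ 2 + q ^+ 2, s = s ^+ 2 + q ^+ 2 &
          (forall u, phi (f x) (L u) = 0) -> p + s = m%:R]].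
Proof.
move=> Linj Lr /=.
have gsym := Defs.metric_sym g_metric (f x).
have Linv u : exists w, L w = phi (f x) (L u).
  have : tangent_space f x (L u) by rewrite -Lr; exists u.
  by move/f_inv; rewrite -Lr => -[w _ <-]; exists w.
have [|||z1 [z2 [p [q [s [z1E z2E Lz1 Lz2 H]]]]]] := @invariant_subspace R m n
  (g (f x)) (phi (f x)) L (Z1 (f x)) (Z2 (f x)) (metric_linear g_metric (f x)) gsym
  (metric_pos g_metric (f x)) _ _ (phiZ1 _) (phiZ2 _) _ Linj Linv.
- by rewrite gZ2.
- by move=> u; rewrite phi_sqr gZ1 gZ2.
- exact: phi_skew.
have P1 : reeb_tan1 x = L z1 by rewrite /reeb_tan1 -Lr; exact: tangent_partE.
have P2 : reeb_tan2 x = L z2 by rewrite /reeb_tan2 -Lr; exact: tangent_partE.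
have -> : gram11 x = p.
  by rewrite /gram11 P1 Lz1 linearD !linearZ /= a1Z1 a1Z2 mulr1 mulr0 addr0.
have -> : gram12 x = q.
  by rewrite /gram12 P1 Lz1 linearD !linearZ /= a2Z1 a2Z2 mulr1 mulr0 add0r.
have -> : gram22 x = s.
  by rewrite /gram22 P2 Lz2 linearD !linearZ /= a2Z1 a2Z2 mulr1 mulr0 add0r.
exists z1, z2; split=> //.
by split=> u; rewrite ?z1E ?z2E gsym ?gZ1 ?gZ2.
Qed.

Let b1 c := pulled_form f a1 c.
Let b2 c := pulled_form f a2 c.

(** On the tangent space of [N] the sum of the two exterior derivatives is the skew form of [phi]. *)
Lemma ext_d_sum c y u v : atlas N c -> cdom c y ->
  ext_d (b1 c) (c y) u v + ext_d (b2 c) (c y) u v =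
  2 * g (f y) (local_diff f c y u) (phi (f y) (local_diff f c y v)).
Proof.
move=> ac cy; rewrite g_phi mulrDr /b1 /b2.
by rewrite (ext_d_pulled_form f_smooth a1_smooth) // (ext_d_pulled_form f_smooth a2_smooth).
Qed.

Lemma ext_d_reeb c y z p q : atlas N c -> cdom c y ->
  local_diff f c y z = p *: Z1 (f y) + q *: Z2 (f y) ->
  forall u, ext_d (b1 c) (c y) z u = 0 /\ ext_d (b2 c) (c y) z u = 0.
Proof.
move=> ac cy zE u.
have d0 (a : M -> {scalar 'rV[R]_n}) (sa : smooth_form a) w : dform a (f y) 0 w = 0.
  have := dform_linear_comb sa (f y) (-1) 0 0 w.
  by rewrite scaler0 addr0 mulN1r addNr.
rewrite /b1 /b2 (ext_d_pulled_form f_smooth a1_smooth) //.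
rewrite (ext_d_pulled_form f_smooth a2_smooth) // zE -[q *: _]addr0.
rewrite !(dform_linear_comb a1_smooth) !(dform_linear_comb a2_smooth).
by rewrite d1Z1 d1Z2 d2Z1 d2Z2 !d0 // !mulr0 !addr0 !mulr0.
Qed.

Let L_frame c y : atlas N c -> cdom c y ->
  injective (local_diff f c y) /\ range (local_diff f c y) = tangent_space f y.
Proof.
move=> ac cy; split; last exact: (local_diff_range f_smooth ac cy).
by apply: (local_diff_inj f_smooth ac cy); exact: (submanifold_immersion f_sub).
Qed.

Let phi_L_eq0 c y u : gram11 y = 0 -> gram22 y = 0 -> atlas N c -> cdom c y ->
  phi (f y) (local_diff f c y u) = 0 -> u = 0.
Proof.
move=> p0 s0 ac cy phiu; have [Linj Lr] := L_frame ac cy.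
have [z1 [z2 [_ Lz1 Lz2 [b1E b2E] [_ Ep _ _]]]] := projection_coordinates Linj Lr.
have q0 : gram12 y = 0.
  by move: Ep; rewrite p0 expr0n add0r => /esym/eqP; rewrite expf_eq0 => /eqP.
have g0 v : g (f y) 0 v = 0.
  by rewrite -(subrr (0 : 'rV_n)) metric_sub subrr.
have az1 : a1 (f y) (local_diff f c y u) = 0.
  by rewrite -b1E Lz1 p0 q0 !scale0r addr0 g0.
have az2 : a2 (f y) (local_diff f c y u) = 0.
  by rewrite -b2E Lz2 s0 q0 !scale0r addr0 g0.
apply: Linj; rewrite linear0.
have := phi_sqr (f y) (local_diff f c y u).
rewrite phiu linear0 az1 az2 !scale0r !addr0 => /eqP.
by rewrite eq_sym oppr_eq0 => /eqP.
Qed.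

(** The other possibility is a vanishing Gram matrix at [y0].  Then [phi] is injective on the tangent
    space at [y0], so the matrix [Om] of [d b1 + d b2] is invertible at [y0], hence at all nearby
    points.  There the Gram matrix cannot be the identity, for then [Z1] would be a tangent vector in
    the kernel of [phi].  So it vanishes, both pulled back forms vanish near [y0], and [Om] is zero at
    [y0]. *)
Lemma gram_even y0 : ~~ odd m -> (0 < m)%N -> gram11 y0 = 1 /\ gram22 y0 = 1.
Proof.
move=> mE m0.
pose c := chart_at N y0; pose C := chart_at M (f y0).
have ac : atlas N c by exact: atlas_chart_at.
have aC : atlas M C by exact: atlas_chart_at.
have cy0 : cdom c y0 by exact: cdom_chart_at.
have Cy0 : cdom C (f y0) by exact: cdom_chart_at.
have [L0inj L0r] := L_frame ac cy0.
have [_ [_ [_ _ _ _ [+ _ _ _]]]] := projection_coordinates L0inj L0r.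
case=> [[_ p0 q0 s0]|[_ p1 _ s1] //|[mO]]; last by rewrite mO in mE.
exfalso.
have D0 : local_dom f c C (c y0) by exists y0.
have oD := @open_local_dom R m n N M f f_smooth.1 c C.
pose Om z := \matrix_(i < m, j < m) (ext_d (b1 c) z 'e_i 'e_j + ext_d (b2 c) z 'e_i 'e_j).
have OmE y u j : cdom c y -> (u *m Om (c y)) 0 j =
    - (2 * g (f y) (local_diff f c y 'e_j) (phi (f y) (local_diff f c y u))).
  move=> cy; rewrite mxE.
  transitivity (\sum_i u 0 i * (2 * g (f y) (local_diff f c y 'e_i)
      (phi (f y) (local_diff f c y 'e_j)))).
    by apply: eq_bigr => i _; rewrite mxE ext_d_sum.
  rewrite phi_skew mulrN opprK (linear_row_sum (local_diff f c y) u).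
  under eq_bigr do rewrite mulrCA.
  rewrite -mulr_sumr; congr (_ * _); apply: esym.
  have := scalar_row_sum u (a := fun w => g (f y) (local_diff f c y w)
      (phi (f y) (local_diff f c y 'e_j))).
  rewrite (linear_row_sum (local_diff f c y) u); apply => r x x'.
  by rewrite linearP; exact: (metric_linear g_metric).
have kerOm y u : cdom c y -> u *m Om (c y) = 0 -> phi (f y) (local_diff f c y u) = 0.
  move=> cy uOm; have [Linj Lr] := L_frame ac cy.
  have : tangent_space f y (phi (f y) (local_diff f c y u)).
    by apply: f_inv; rewrite -Lr; exists u.
  rewrite -Lr => -[w _ wE]; rewrite -wE.
  apply: (inner_eq0 (metric_pos g_metric (f y))).
  rewrite {2}wE.
  have E : g (f y) (local_diff f c y w) (phi (f y) (local_diff f c y u)) =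
      \sum_j w 0 j * g (f y) (local_diff f c y 'e_j) (phi (f y) (local_diff f c y u)).
    apply: (@scalar_row_sum _ _ (fun w => g (f y) (local_diff f c y w) _)) => r x x'.
    by rewrite linearP; exact: (metric_linear g_metric).
  apply: etrans E _; apply: big1 => j _.
  suff -> : g (f y) (local_diff f c y 'e_j) (phi (f y) (local_diff f c y u)) = 0.
    by rewrite mulr0.
  have := OmE y u j cy; rewrite uOm [LHS]mxE => /esym/eqP.
  by rewrite oppr_eq0 mulf_eq0 pnatr_eq0 /= => /eqP.
have phi0 u : phi (f y0) (local_diff f c y0 u) = 0 -> u = 0.
  exact: phi_L_eq0.
have det0 : \det (Om (c y0)) != 0.
  rewrite -unitfE -unitmxE -row_free_unit; apply/inj_row_free => u /(kerOm _ _ cy0).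
  exact: phi0.
have cE (a : M -> {scalar 'rV[R]_n}) u v : smooth_form a ->
    {for c y0, continuous (fun z => ext_d (pulled_form f a c) z u v : R^o)}.
  move=> sa.
  have H w w' : {for c y0, continuous ('D_w (pulled_form f a c ^~ w'))}.
    apply: differentiable_continuous.
    exact: ((pulled_form_Ck2 f_smooth sa w' ac aC).2 w).1.
  by apply: continuousB; exact: H.
have detn : \forall z \near c y0, \det (Om z) != 0.
  apply: (cvgr_neq0 _ (cvg_det (nbhs_filter (c y0)) _) det0) => i j.
  have : {for c y0, continuous (fun z => ext_d (b1 c) z 'e_i 'e_j +
      ext_d (b2 c) z 'e_i 'e_j : R^o)} by apply: continuousD; exact: cE.
  have -> : (fun z => ext_d (b1 c) z 'e_i 'e_j + ext_d (b2 c) z 'e_i 'e_j : R^o) =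
      (fun z => Om z i j) by apply/funext => z; rewrite mxE.
  exact.
have near0 : \forall z \near c y0, b1 c z =1 (fun=> 0) /\ b2 c z =1 (fun=> 0).
  apply: filterS2 detn (open_nbhs_nbhs (conj oD D0)) => z dz [y [cy Cy] zE].
  rewrite -zE in dz *.
  have [Linj Lr] := L_frame ac cy.
  have [z1 [z2 [_ Lz1 Lz2 [b1E b2E] [+ _ _ _]]]] := projection_coordinates Linj Lr.
  have g0 v : g (f y) 0 v = 0.
    by rewrite -(subrr (0 : 'rV_n)) metric_sub subrr.
  case=> [[_ p y0' s]|[_ p y0' s]|[mO]]; last by rewrite mO in mE.
    split=> u.
      apply: etrans (pulled_form_chart f a1 u cy) _.
      by rewrite -b1E Lz1 p y0' !scale0r addr0 g0.
    apply: etrans (pulled_form_chart f a2 u cy) _.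
    by rewrite -b2E Lz2 s y0' !scale0r addr0 g0.
  have z10 : z1 = 0.
    have uO : Om (c y) \in unitmx by rewrite unitmxE unitfE.
    suff : z1 *m Om (c y) = 0 by move/(canRL (mulmxK uO)); rewrite mul0mx.
    have pz1 : phi (f y) (local_diff f c y z1) = 0.
      by rewrite Lz1 p y0' scale1r scale0r addr0 phiZ1.
    apply/rowP => j; apply: etrans (OmE y z1 j cy) _.
    by rewrite pz1 (Defs.metric_sym g_metric) g0 mulr0 oppr0 [RHS]mxE.
  have := a1Z1 (f y); have : Z1 (f y) = 0.
    by move: Lz1; rewrite z10 linear0 p y0' scale1r scale0r addr0.
  by move=> ->; rewrite linear0 => /eqP; rewrite eq_sym oner_eq0.
have ext0 : ext_d (fun _ _ => 0 : R^o) (c y0) =2 (fun _ _ => 0).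
  by move=> u v; rewrite /ext_d !derive_cst subrr.
have Om0 : Om (c y0) = 0.
  apply/matrixP => i j; rewrite !mxE.
  have n1 : \forall z \near c y0, b1 c z =1 (fun=> 0) by apply: filterS near0 => z [].
  have n2 : \forall z \near c y0, b2 c z =1 (fun=> 0) by apply: filterS near0 => z [].
  by rewrite (near_eq_ext_d _ _ n1) (near_eq_ext_d _ _ n2) !ext0 addr0.
have u0 : const_mx 1 = 0 :> 'rV[R]_m.
  by apply: phi0; apply: kerOm => //; rewrite Om0 mulmx0.
by have /eqP := congr1 (fun u : 'rV[R]_m => u 0 (Ordinal m0)) u0; rewrite !mxE oner_eq0.
Qed.

(** The diagonal entry [P] and the off-diagonal entry [Q] satisfy [P = 1 / (1 + (Q / P)^2)], and [Q / P]
    is the ratio of the two pulled back forms, which [ratio_locally_constant] shows to be locally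
    constant.  The statement is symmetric in the two contact forms, so that it can be used for either
    diagonal entry. *)
Lemma gram_near (a a' : M -> {scalar 'rV[R]_n}) (P Q : N -> R) y0 :
  smooth_form a -> smooth_form a' ->
  (forall c y, atlas N c -> cdom c y ->
     exists z, [/\ forall u, g (f y) (local_diff f c y z) (local_diff f c y u) =
                             a (f y) (local_diff f c y u),
       a (f y) (local_diff f c y z) = P y /\ a' (f y) (local_diff f c y z) = Q y,
       P y = P y ^+ 2 + Q y ^+ 2,
       forall u, P y * a' (f y) (local_diff f c y u) =
                 Q y * a (f y) (local_diff f c y u) &
       forall u, ext_d (pulled_form f a c) (c y) z u = 0 /\
                 ext_d (pulled_form f a' c) (c y) z u = 0]) ->
  (forall c y, atlas N c -> cdom c y -> exists u v,
     ext_d (pulled_form f a c) (c y) u v + ext_d (pulled_form f a' c) (c y) u v != 0) ->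
  P y0 != 0 -> \forall y \near y0, P y = P y0.
Proof.
move=> sa sa' frame nz P0.
pose c := chart_at N y0; pose C := chart_at M (f y0).
have ac : atlas N c by exact: atlas_chart_at.
have aC : atlas M C by exact: atlas_chart_at.
have cy0 : cdom c y0 by exact: cdom_chart_at.
have Cy0 : cdom C (f y0) by exact: cdom_chart_at.
have D0 : local_dom f c C (c y0) by exists y0.
have oD := @open_local_dom R m n N M f f_smooth.1 c C.
have [v0 [_ [av0 av0'] _ _ _]] := frame c y0 ac cy0.
pose b := pulled_form f a c; pose b' := pulled_form f a' c.
have bE y u : cdom c y -> b (c y) u = a (f y) (local_diff f c y u).
  exact: pulled_form_chart.
have b'E y u : cdom c y -> b' (c y) u = a' (f y) (local_diff f c y u).
  exact: pulled_form_chart.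
have Pn0 y : cdom c y -> b (c y) v0 != 0 -> P y != 0.
  move=> cy; have [z [zE [az _] _ _ _]] := frame c y ac cy.
  rewrite (bE y v0 cy); apply: contra => /eqP Py; rewrite -zE.
  have Lz : local_diff f c y z = 0.
    by apply: (inner_eq0 (metric_pos g_metric (f y))); rewrite zE az Py.
  by rewrite Lz -(subrr (0 : 'rV_n)) metric_sub subrr.
have PQb y w : cdom c y -> P y * b' (c y) w = Q y * b (c y) w.
  move=> cy; have [z [_ _ _ PQ _]] := frame c y ac cy.
  apply: etrans (congr1 ( *%R (P y)) (b'E y w cy)) _; apply: etrans (PQ w) _.
  exact: (congr1 ( *%R (Q y)) (esym (bE y w cy))).
have ratioE y : cdom c y -> b (c y) v0 != 0 -> b' (c y) v0 / b (c y) v0 = Q y / P y.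
  by move=> cy bn; exact: (ratio_eq bn (Pn0 _ cy bn) (PQb y v0 cy)).
have PE y : cdom c y -> P y != 0 -> P y = (1 + (Q y / P y) ^+ 2)^-1.
  by move=> cy Pn; have [_ [_ _ E _ _]] := frame c y ac cy; exact: eq_inv_ratio.
have b0 : b (c y0) v0 != 0 by rewrite (bE y0 v0 cy0) av0.
have near_z : \forall z \near c y0, b z v0 != 0 /\
    b' z v0 / b z v0 = b' (c y0) v0 / b (c y0) v0.
  apply: (ratio_locally_constant oD D0) => //.
  - by move=> w; exact: pulled_form_Ck2.
  - by move=> w; exact: pulled_form_Ck2.
  - move=> _ w [y [cy Cy] <-] bn; have Pn := Pn0 _ cy bn.
    exact: (ratio_cross Pn (PQb y w cy) (PQb y v0 cy)).
  - move=> _ [y [cy Cy] <-] bn; have Pn := Pn0 _ cy bn.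
    have [z [_ [az _] _ _ dz]] := frame c y ac cy; exists z; split.
    + by rewrite (bE y z cy) az.
    + by move=> u; exact: (dz u).1.
    + by move=> u; exact: (dz u).2.
  - by move=> _ [y [cy Cy] <-]; exact: nz.
have near_y : \forall y \near y0, b (c y) v0 != 0 /\
    b' (c y) v0 / b (c y) v0 = b' (c y0) v0 / b (c y0) v0.
  exact: (cfun_continuous cy0 near_z).
apply: filterS2 near_y (open_nbhs_nbhs (conj (cdom_open c) cy0)) => y [bn rE] cy.
rewrite (PE y cy (Pn0 _ cy bn)) (PE y0 cy0 P0).
by rewrite (etrans (esym (ratioE y cy bn)) (etrans rE (ratioE y0 cy0 b0))).
Qed.

Lemma gram_odd_sum y : odd m -> gram11 y + gram22 y = 1.
Proof.
move=> mO; have [Linj Lr] := L_frame (atlas_chart_at y) (cdom_chart_at y).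
have [_ [_ [_ _ _ _ [cases _ _ _]]]] := projection_coordinates Linj Lr.
case: cases => [[mE _ _ _]|[mE _ _ _]|[_ ps _]]; last exact: ps.
  by rewrite mO in mE.
by rewrite mO in mE.
Qed.

(** Otherwise [phi] vanishes on the tangent space, whose dimension is then the trace of the Gram
    matrix, that is [1]. *)
Lemma ext_d_nonzero c y : odd m -> (3 <= m)%N -> atlas N c -> cdom c y ->
  exists u v, ext_d (b1 c) (c y) u v + ext_d (b2 c) (c y) u v != 0.
Proof.
move=> mO m3 ac cy; apply: contrapT => nex.
have [Linj Lr] := L_frame ac cy.
have [z1 [z2 [_ _ _ _ [_ _ _ dimE]]]] := projection_coordinates Linj Lr.
have : (m%:R : R) = 1.
  rewrite -dimE; first exact: gram_odd_sum.
  move=> v.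
  have : tangent_space f y (phi (f y) (local_diff f c y v)).
    by apply: f_inv; rewrite -Lr; exists v.
  rewrite -Lr => -[u _ uE]; rewrite -uE.
  apply: (inner_eq0 (metric_pos g_metric (f y))); rewrite {2}uE.
  apply/eqP/negPn/negP => gn; apply: nex; exists u, v.
  rewrite (ext_d_sum u v ac cy); apply: mulf_neq0 gn.
  by rewrite pnatr_eq0.
by move/eqP; rewrite -[1]/(1%:R) eqr_nat => /eqP m1; rewrite m1 in m3.
Qed.

Lemma gram_odd_near y0 : odd m -> (3 <= m)%N ->
  \forall y \near y0, gram11 y = gram11 y0.
Proof.
move=> mO m3.
have sum1 y : gram11 y + gram22 y = 1 by exact: gram_odd_sum.
have frame c y : atlas N c -> cdom c y -> exists z1 z2,
    [/\ (forall u, g (f y) (local_diff f c y z1) (local_diff f c y u) =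
                   a1 (f y) (local_diff f c y u)) /\
        (forall u, g (f y) (local_diff f c y z2) (local_diff f c y u) =
                   a2 (f y) (local_diff f c y u)),
        [/\ a1 (f y) (local_diff f c y z1) = gram11 y,
            a2 (f y) (local_diff f c y z1) = gram12 y,
            a1 (f y) (local_diff f c y z2) = gram12 y &
            a2 (f y) (local_diff f c y z2) = gram22 y],
        gram11 y = gram11 y ^+ 2 + gram12 y ^+ 2 /\
        gram22 y = gram22 y ^+ 2 + gram12 y ^+ 2,
        (forall u, gram11 y * a2 (f y) (local_diff f c y u) =
                   gram12 y * a1 (f y) (local_diff f c y u)) /\
        (forall u, gram22 y * a1 (f y) (local_diff f c y u) =
                   gram12 y * a2 (f y) (local_diff f c y u)) &
        (forall u, ext_d (b1 c) (c y) z1 u = 0 /\ ext_d (b2 c) (c y) z1 u = 0) /\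
        (forall u, ext_d (b1 c) (c y) z2 u = 0 /\ ext_d (b2 c) (c y) z2 u = 0)].
  move=> ac cy; have [Linj Lr] := L_frame ac cy.
  have [z1 [z2 [_ Lz1 Lz2 [b1E b2E] [_ Ep Es _]]]] := projection_coordinates Linj Lr.
  have gz p q u : g (f y) (p *: Z1 (f y) + q *: Z2 (f y)) u =
      p * a1 (f y) u + q * a2 (f y) u.
    by rewrite (Defs.metric_sym g_metric) -gZ1 -gZ2 !(Defs.metric_sym g_metric _ u)
      (metric_linear g_metric (f y) u) -[q *: _]addr0 (metric_linear g_metric (f y) u)
      -(subrr (0 : 'rV_n)) metric_sub subrr addr0.
  have a1E p q : a1 (f y) (p *: Z1 (f y) + q *: Z2 (f y)) = p.
    by rewrite linearD !linearZ /= a1Z1 a1Z2 mulr1 mulr0 addr0.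
  have a2E p q : a2 (f y) (p *: Z1 (f y) + q *: Z2 (f y)) = q.
    by rewrite linearD !linearZ /= a2Z1 a2Z2 mulr1 mulr0 add0r.
  exists z1, z2; split.
  - exact: (conj b1E b2E).
  - split; [rewrite Lz1; exact: a1E | rewrite Lz1; exact: a2E |
           rewrite Lz2; exact: a1E | rewrite Lz2; exact: a2E].
  - exact: (conj Ep Es).
  - split=> u.
      have := b2E u; rewrite Lz2 gz => H.
      have s1 : gram22 y + gram11 y = 1 by rewrite addrC.
      exact: (@complement_eq R (gram11 y) (gram12 y) (gram22 y) _ _ H s1).
    have := b1E u; rewrite Lz1 gz addrC => H.
    exact: (@complement_eq R (gram22 y) (gram12 y) (gram11 y) _ _ H (sum1 y)).
  - by split; [exact: (ext_d_reeb ac cy Lz1) | exact: (ext_d_reeb ac cy Lz2)].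
have [p0|p0] := eqVneq (gram11 y0) 0; last first.
  apply: (@gram_near a1 a2 gram11 gram12) => //; last first.
    by move=> c y ac cy; exact: ext_d_nonzero.
  move=> c y ac cy; have [z1 [z2 [[E _] [A1 A2 _ _] [Ep _] [PQ _] [d _]]]] := frame c y ac cy.
  by exists z1; split.
have s0 : gram22 y0 != 0 by have := sum1 y0; rewrite p0 add0r => ->; exact: oner_neq0.
have ns : \forall y \near y0, gram22 y = gram22 y0.
  apply: (@gram_near a2 a1 gram22 gram12) => //; last first.
    move=> c y ac cy; have [u [v]] := ext_d_nonzero mO m3 ac cy.
    by rewrite addrC; exists u, v.
  move=> c y ac cy; have [z1 [z2 [[_ E] [_ _ A1 A2] [_ Es] [_ PQ] [_ d]]]] := frame c y ac cy.
  by exists z2; split => // u; have [] := d u.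
apply: filterS ns => y sE; apply: (addIr (gram22 y)).
by apply: etrans (sum1 y) _; rewrite sE; exact: esym (sum1 y0).
Qed.

Let frame_at x : exists (L : {linear 'rV[R]_m -> 'rV[R]_n}) z1 z2,
  [/\ range L = tangent_space f x,
      reeb_tan1 x = L z1 /\ reeb_tan2 x = L z2,
      L z1 = gram11 x *: Z1 (f x) + gram12 x *: Z2 (f x),
      L z2 = gram12 x *: Z1 (f x) + gram22 x *: Z2 (f x) &
      [/\ forall u, g (f x) (L z1) (L u) = a1 (f x) (L u),
          forall u, g (f x) (L z2) (L u) = a2 (f x) (L u),
          gram11 x = gram11 x ^+ 2 + gram12 x ^+ 2 &
          gram22 x = gram22 x ^+ 2 + gram12 x ^+ 2]].
Proof.
have [Linj Lr] := L_frame (atlas_chart_at x) (cdom_chart_at x).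
have [z1 [z2 [P Lz1 Lz2 [b1E b2E] [_ Ep Es _]]]] := projection_coordinates Linj Lr.
by exists (local_diff f (chart_at N x) x), z1, z2; split.
Qed.

Let inner0 p u : g p 0 u = 0.
Proof. by rewrite -(subrr (0 : 'rV_n)) metric_sub subrr. Qed.

Lemma gram11_eq1 x : gram11 x = 1 <-> tangent_at f Z1 x.
Proof.
have [L [z1 [z2 [Lr [P1 _] Lz1 _ [b1E _ Ep _]]]]] := frame_at x.
rewrite /tangent_at -Lr; split=> [p1|[u _ uE]].
  exists z1 => //; have q0 : gram12 x = 0 by move: Ep; rewrite p1; nra.
  by rewrite Lz1 p1 q0 scale1r scale0r addr0.
by rewrite /gram11 P1 -gZ1 -uE b1E uE a1Z1.
Qed.

Lemma gram22_eq1 x : gram22 x = 1 <-> tangent_at f Z2 x.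
Proof.
have [L [z1 [z2 [Lr [_ P2] _ Lz2 [_ b2E _ Es]]]]] := frame_at x.
rewrite /tangent_at -Lr; split=> [p1|[u _ uE]].
  exists z2 => //; have q0 : gram12 x = 0 by move: Es; rewrite p1; nra.
  by rewrite Lz2 p1 q0 scale1r scale0r add0r.
by rewrite /gram22 P2 -gZ2 -uE b2E uE a2Z2.
Qed.

Lemma gram11_eq0 x : gram11 x = 0 <-> orthogonal_at f g Z1 x.
Proof.
have [L [z1 [z2 [Lr [P1 _] Lz1 _ [b1E _ Ep _]]]]] := frame_at x.
rewrite /orthogonal_at -Lr; split=> [p0 _ [u _ <-]|orth].
  have q0 : gram12 x = 0 by move: Ep; rewrite p0; nra.
  rewrite (Defs.metric_sym g_metric) gZ1 -b1E Lz1 p0 q0 !scale0r addr0.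
  exact: inner0.
rewrite /gram11 P1 -gZ1 (Defs.metric_sym g_metric); apply: orth.
by exists z1.
Qed.

Lemma gram22_eq0 x : gram22 x = 0 <-> orthogonal_at f g Z2 x.
Proof.
have [L [z1 [z2 [Lr [_ P2] _ Lz2 [_ b2E _ Es]]]]] := frame_at x.
rewrite /orthogonal_at -Lr; split=> [p0 _ [u _ <-]|orth].
  have q0 : gram12 x = 0 by move: Es; rewrite p0; nra.
  rewrite (Defs.metric_sym g_metric) gZ2 -b2E Lz2 p0 q0 !scale0r addr0.
  exact: inner0.
rewrite /gram22 P2 -gZ2 (Defs.metric_sym g_metric); apply: orth.
by exists z2.
Qed.

Lemma angle_with_Z1 x :
  angle_with f g Z1 x = acos (gram11 x / (Num.sqrt 1 * Num.sqrt (gram11 x))).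
Proof.
have [L [z1 [z2 [_ [P1 _] _ _ [b1E _ _ _]]]]] := frame_at x.
rewrite /angle_with -/(reeb_tan1 x) /angle gZ1 a1Z1 (Defs.metric_sym g_metric) gZ1.
have -> : g (f x) (reeb_tan1 x) (reeb_tan1 x) = gram11 x by rewrite /gram11 P1 b1E.
by [].
Qed.

Lemma angle_with_Z2 x :
  angle_with f g Z2 x = acos (gram22 x / (Num.sqrt 1 * Num.sqrt (gram22 x))).
Proof.
have [L [z1 [z2 [_ [_ P2] _ _ [_ b2E _ _]]]]] := frame_at x.
rewrite /angle_with -/(reeb_tan2 x) /angle gZ2 a2Z2 (Defs.metric_sym g_metric) gZ2.
have -> : g (f x) (reeb_tan2 x) (reeb_tan2 x) = gram22 x by rewrite /gram22 P2 b2E.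
by [].
Qed.

Lemma tangent_line_vertical x u : m = 1%N -> tangent_space f x u ->
  vertical_dist Z1 Z2 (f x) u.
Proof.
move=> m1; have [L [z1 [z2 [<- [P1 P2] Lz1 Lz2 _]]]] := frame_at x.
case=> w _ <-.
have sum1 : gram11 x + gram22 x = 1 by apply: gram_odd_sum; rewrite m1.
have [z10|z1n] := eqVneq z1 0; last first.
  have [t ->] := row1_colinear w m1 z1n.
  exists (t * gram11 x), (t * gram12 x).
  by rewrite linearZ /= Lz1 scalerDr !scalerA.
have [z20|z2n] := eqVneq z2 0; last first.
  have [t ->] := row1_colinear w m1 z2n.
  exists (t * gram12 x), (t * gram22 x).
  by rewrite linearZ /= Lz2 scalerDr !scalerA.
move: sum1; rewrite /gram11 /gram22 P1 P2 z10 z20 !linear0 addr0 => /esym/eqP.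
by rewrite oner_eq0.
Qed.

End InvariantSubmanifold.

(** * The classification *)

Unset Implicit Arguments.

Theorem theorem13 (R : realType) (h k : nat)
    (M : manifold R (2 + (2 * h + 2 * k)))
    (a1 a2 : M -> {scalar 'rV[R]_(2 + (2 * h + 2 * k))})
    (Z1 Z2 : M -> 'rV[R]_(2 + (2 * h + 2 * k)))
    (phi : M -> {linear 'rV[R]_(2 + (2 * h + 2 * k)) ->
                        'rV[R]_(2 + (2 * h + 2 * k))})
    (g : M -> 'rV[R]_(2 + (2 * h + 2 * k)) ->
         'rV[R]_(2 + (2 * h + 2 * k)) -> R)
    (V : @foliation R 2 (2 * h + 2 * k) M)
    (m : nat) (N : manifold R m) (f : N -> M) :
  metric_contact_pair a1 a2 Z1 Z2 phi g ->
  decomposable a1 a2 phi ->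
  foliation_tangent_to V (vertical_dist Z1 Z2) ->
  (0 < m)%N ->
  submanifold f ->
  [set: N] !=set0 ->
  connected [set: N] ->
  phi_invariant f phi ->
  [\/ ~~ odd m /\ (forall x, tangent_at f Z1 x /\ tangent_at f Z2 x),
      m = 1%N /\ (exists2 L, is_leaf V L & range f `<=` L),
      [/\ odd m, (3 <= m)%N &
          (forall x, tangent_at f Z1 x /\ orthogonal_at f g Z2 x) \/
          (forall x, tangent_at f Z2 x /\ orthogonal_at f g Z1 x)] |
      [/\ odd m, (3 <= m)%N,
          (forall x, ~ tangent_at f Z1 x /\ ~ tangent_at f Z2 x),
          (forall x, ~ orthogonal_at f g Z1 x /\ ~ orthogonal_at f g Z2 x) &
          (exists t, forall x, angle_with f g Z1 x = t) /\
          (exists t, forall x, angle_with f g Z2 x = t)] ].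
Proof.
move=> mcp _ F_tangent m0 f_sub N0 cN f_inv.
case: (boolP (odd m)) => mO; last first.
  apply: Or41; split=> // x; have [p1 s1] := gram_even mcp f_sub f_inv x mO m0.
  by split; [exact/(gram11_eq1 mcp f_sub f_inv) | exact/(gram22_eq1 mcp f_sub f_inv)].
have [m1|m_neq1] := eqVneq m 1%N.
  apply: Or42; split=> //.
  apply: (tangent_submanifold_in_leaf (submanifold_smooth f_sub) F_tangent) => // x u.
  exact: (tangent_line_vertical mcp f_sub f_inv m1).
have m3 : (3 <= m)%N by case: (m) m0 mO m_neq1 => [|[|[]]].
have [x0 _] := N0.
pose p := gram11 f a1 Z1 g; pose s := gram22 f a2 Z2 g.
have pE x : p x = p x0.
  by apply: (connected_locally_constant cN) => y; exact: (gram_odd_near mcp f_sub f_inv).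
have psE x : p x + s x = 1 := gram_odd_sum mcp f_sub f_inv x mO.
have sE x : s x = s x0.
  apply: (addrI (p x)); apply: etrans (psE x) _.
  by rewrite (pE x); exact: esym (psE x0).
have [p1|p_neq1] := eqVneq (p x0) 1.
  apply: Or43; split=> //; left=> x; split.
    by apply/(gram11_eq1 mcp f_sub f_inv); rewrite -/(p x) (pE x).
  apply/(gram22_eq0 mcp f_sub f_inv); apply: (addrI (p x)).
  by apply: etrans (psE x) _; rewrite (pE x) p1 addr0.
have [p0|p_neq0] := eqVneq (p x0) 0.
  apply: Or43; split=> //; right=> x; split.
    apply/(gram22_eq1 mcp f_sub f_inv); apply: (addrI (p x)).
    by apply: etrans (psE x) _; rewrite (pE x) p0 add0r.
  by apply/(gram11_eq0 mcp f_sub f_inv); rewrite -/(p x) (pE x).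
apply: Or44; split=> //.
- move=> x; split.
    by move/(gram11_eq1 mcp f_sub f_inv)/eqP; rewrite -/(p x) (pE x) (negbTE p_neq1).
  move/(gram22_eq1 mcp f_sub f_inv) => s1; move/eqP: p_neq0; apply.
  apply: (addIr (s x)); rewrite -(pE x) add0r.
  by apply: etrans (psE x) _; exact: esym s1.
- move=> x; split.
    by move/(gram11_eq0 mcp f_sub f_inv)/eqP; rewrite -/(p x) (pE x) (negbTE p_neq0).
  move/(gram22_eq0 mcp f_sub f_inv) => s0; move/eqP: p_neq1; apply.
  rewrite -(pE x) -[LHS]addr0; apply: etrans (psE x).
  exact: (congr1 ( +%R (p x)) (esym s0)).
- split; eexists=> x.
    by rewrite (angle_with_Z1 mcp f_sub f_inv) -/(p x) (pE x).
  by rewrite (angle_with_Z2 mcp f_sub f_inv) -/(s x) (sE x).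
Qed.
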